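(* Let $V\subset H^0(\mathbb{P}^2,\mathcal{O}_{\mathbb{P}^2}(3))$ be a pencil of plane cubics over $\mathbb{C}$ which has only one base point (set-theoretically) and whose general member is smooth, and let $p$ be its base point. Then one of the following holds: either (1) all members of the pencil are irreducible (in particular reduced), and for any smooth member $C\in|V|$, with the origin of the group law on $C$ fixed in a flex, $p$ is a $9$-torsion point of $C$ which is not $3$-torsion; or (2) $p$ is a flex of every smooth member $C\in|V|$, and the pencil is generated by $C$ and $3L$, where $L$ is the tangent line to $C$ at $p$.
   Context: We work over $\mathbb{C}$. A pencil of plane cubics is a $2$-dimensional linear subspace $V\subset H^0(\mathbb{P}^2,\mathcal{O}_{\mathbb{P}^2}(3))$, with associated linear system $|V|=\mathbb{P}(V)$; its members are the cubic curves defined by nonzero elements of $V$, and its base points are the points common to all members. Here $3L$ denotes the non-reduced cubic defined by $\ell^3=0$, where $\ell=0$ is the equation of the line $L$. A point $q\in C$ is $n$-torsion if $nq=0$ in the group law on $C$ with the chosen origin. *)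

(* Defs.v *)
From mathcomp Require Export all_boot all_order all_algebra.
From mathcomp Require Export reals.
From mathcomp.real_closed Require Export complex.
From mathcomp Require Export mpoly.

Set Implicit Arguments.
Unset Strict Implicit.
Unset Printing Implicit Defensive.

Import GRing.Theory.
Local Open Scope ring_scope.

Definition irreducible_elt (D : idomainType) (a : D) : Prop :=
  [/\ a != 0, a \isn't a GRing.unit &
      forall b c : D, a = b * c ->
        b \is a GRing.unit \/ c \is a GRing.unit].

Section PlaneCurves.
Variable K : fieldType.

(* H^0(P^2, O(d)) *)
Definition ternary_form (d : nat) := dhomog 3 K d.

Lemma cube_subproof (l : ternary_form 1) :
  (l : {mpoly K[3]}) ^+ 3 \is 3.-homog.
Proof. exact: (dhomogMn 3 (dhomog_is_dhomog l)). Qed.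

Definition cube (l : ternary_form 1) : ternary_form 3 :=
  DHomog (cube_subproof l).

(* P^2 as the set of 1-dimensional subspaces of K^3; a projective line is
   likewise a 2-dimensional subspace. *)
Definition point := {U : {vspace 'rV[K]_3} | \dim U == 1%N}.

Definition evalv (F : {mpoly K[3]}) (v : 'rV[K]_3) : K := F.@[v 0].

Definition on_curve d (F : ternary_form d) (x : point) : Prop :=
  forall v, v \in val x -> evalv F v = 0.

Definition gradient d (F : ternary_form d) (v : 'rV[K]_3) : 'cV[K]_3 :=
  \col_i evalv (mderiv i F) v.

(* Jacobian criterion; [vpick (val x)] is a vector of homogeneous coordinates
   of x. *)
Definition smooth_at d (F : ternary_form d) (x : point) : Prop :=
  on_curve F x /\ gradient F (vpick (val x)) != 0.

Definition smooth_curve d (F : ternary_form d) : Prop :=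
  forall x, on_curve F x -> smooth_at F x.

(* The projective tangent line: all w with sum_i (dF/dX_i)(x) w_i = 0. *)
Definition tangent_line d (F : ternary_form d) (x : point) :
    {vspace 'rV[K]_3} :=
  lker (linfun (mulmxr (gradient F (vpick (val x))) : 'rV[K]_3 -> 'rV[K]_1)).

Definition line_equation (l : ternary_form 1) (L : {vspace 'rV[K]_3}) : Prop :=
  l != 0 /\ forall w, (w \in L) = (evalv l w == 0).

(* F (v + t w), as a polynomial in t *)
Definition restr d (F : ternary_form d) (v w : 'rV[K]_3) : {poly K} :=
  mmap (@polyC K) (fun i => (v 0 i)%:P + w 0 i *: 'X) F.

(* Intersection multiplicity at x of the curve F = 0 with a line L through x:
   L is parametrised as v + t w, where v spans x and w is a point of L other
   than x; the order of vanishing at t = 0 does not depend on v and w.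
   Junk value 0 if F vanishes identically on L (mup a 0 = 0). *)
Definition line_mult d (F : ternary_form d) (L : {vspace 'rV[K]_3})
    (x : point) : nat :=
  mup 0 (restr F (vpick (val x)) (vpick (L :\: val x)%VS)).

Definition flex d (F : ternary_form d) (x : point) : Prop :=
  smooth_at F x /\ (3 <= line_mult F (tangent_line F x) x)%N.

(* The intersection divisor of the line L with the curve F = 0 is the sum of
   the points in s, repeated according to multiplicity. For s nonempty this
   entails that the curve does not contain L, where all multiplicities would
   be the junk value 0. *)
Definition line_divisor d (F : ternary_form d) (L : {vspace 'rV[K]_3})
    (s : seq point) : Prop :=
  [/\ \dim L = 2%N, (forall x, x \in s -> (val x <= L)%VS) &
      forall x, (val x <= L)%VS -> line_mult F L x = count_mem x s].

Section GroupLaw.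
(* Chord-tangent group law with origin o on a smooth cubic F = 0, as the graph
   of a partial operation on the points of P^2, defined on pairs of points of
   the cubic: S = P + Q when S is the third intersection point of the curve
   with the line through o and R, where R is the third intersection point on
   the line through P and Q (tangent lines being taken at coinciding points). *)
Variables (F : ternary_form 3) (o : point).

Definition third_point (P Q R : point) : Prop :=
  exists L, line_divisor F L [:: P; Q; R].

Definition add_point (P Q S : point) : Prop :=
  exists R, third_point P Q R /\ third_point o R S.

(* mul_point n P S : S = n P *)
Fixpoint mul_point (n : nat) (P S : point) : Prop :=
  if n is n'.+1 then exists T, mul_point n' P T /\ add_point T P S
  else S = o.

Definition torsion (n : nat) (P : point) : Prop := mul_point n P o.

End GroupLaw.

Section Pencils.
Variable V : {vspace ternary_form 3}.

(* The members of |V| are represented by the nonzero elements of V. *)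
Definition member (F : ternary_form 3) : Prop := F \in V /\ F != 0.

Definition base_point (x : point) : Prop :=
  forall F, member F -> on_curve F x.

(* P holds on a nonempty Zariski open subset of |V| = P(V); it is enough to
   consider principal open subsets h <> 0, with h a nonzero form in the
   coordinates of V. *)
Definition general_member (P : ternary_form 3 -> Prop) : Prop :=
  exists (e : nat) (h : {mpoly K[\dim V]}),
    [/\ h \is e.-homog, h != 0 &
        forall F, member F ->
          h.@[fun i => coord (vbasis V) i F] != 0 -> P F].

End Pencils.
End PlaneCurves.

(* Main.v *)
From HB Require Import structures.
From mathcomp Require Import ring zify.
From mathcomp Require boolp.
Require Import Defs.

(** Let F be a smooth member of the pencil and G another member, so that the
    curves F = 0 and G = 0 have p as their only common point.

    Put a flex o of F at infinity, with its tangent line as line at infinity.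
    Up to a constant, F becomes y^2 = h(x) with h a monic cubic
    ([flex_weierstrass]).  The functions on the affine part form the ring
    A = K[x] + K[x] y, whose norm N(a + b y) = a^2 - b^2 h has as roots the
    abscissas of the zeros of a + b y.  The degrees of a^2 and b^2 h have
    opposite parity, hence the degree of a norm is never 1
    ([size_norm_neq2]); this is the way in which the proof uses that the curve
    is not rational, and it replaces the theory of divisors.

    Suppose that p is a flex of F, and take o = p.  Then G has no zero on the
    affine part, so its norm is a constant, so G itself is a constant in A; in
    homogeneous terms G = e1 F + e2 l^3, where l = 0 is the tangent line at p
    ([cubic_meeting_at_flex]).  Every smooth member is then a F + b l^3 with a
    nonzero, and has the same contact as F with the line l = 0 at p
    ([flex_of_flex_member]).  This is the second alternative.

    Suppose now that p is a flex of no smooth member.  A reducible member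
    contains a line L, and a smooth member that is not proportional to it meets
    L in p only, hence with multiplicity three, which would make p a flex
    ([flex_of_line]).  If 3 p = o for a flex o, then the chord construction
    shows that the tangent at p meets the curve in p three times, so p would
    again be a flex ([three_torsion_flex]).  Finally let m_T be the ideal of a
    point T in A.  Chords give inclusions u m_p^k <= v m_(k p) in which the
    degrees of N(u) and N(v) are under control ([equiv_power_step]).  The norm
    of G is a constant times (x - x(p))^9, which forces G to lie in m_p^9
    ([power_of_ideal]).  If 9 p were not o, then u G / v would be an element of
    A whose norm has degree 1 ([not_principal]); so 9 p = o
    ([nine_torsion]). *)

Set Implicit Arguments.
Unset Strict Implicit.
Unset Printing Implicit Defensive.

Import Order.TTheory GRing.Theory Num.Theory.
Local Open Scope ring_scope.

(** * Polynomials and polynomial functions *)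

Lemma poly_one_root (K : closedFieldType) (p : {poly K}) (a : K) :
  p != 0 -> (forall x, root p x -> x = a) ->
  exists2 c, c != 0 & p = c *: ('X - a%:P) ^+ (size p).-1.
Proof.
move=> p0 Hr; have [s Es] := closed_field_poly_normal p.
exists (lead_coef p); first by rewrite lead_coef_eq0.
have sa : s = nseq (size s) a.
  apply/all_pred1P/allP => x xs; apply/eqP/Hr.
  by rewrite Es rootZ ?lead_coef_eq0 // root_prod_XsubC.
have E : p = lead_coef p *: ('X - a%:P) ^+ size s.
  by rewrite {1}Es {1}sa big_nseq iter_mulr_1.
have -> : (size p).-1 = size s; last exact: E.
by rewrite [in LHS]E size_scale ?lead_coef_eq0 // size_exp_XsubC.
Qed.

(** Induction along the ring structure instead of the monomial expansion: it
    suits properties that are visibly stable under sums and products. *)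
Lemma mpoly_ring_ind n (R : comNzRingType) (P : {mpoly R[n]} -> Prop) :
  (forall c, P c%:MP) -> (forall i, P 'X_i) ->
  (forall p q, P p -> P q -> P (p + q)) ->
  (forall p q, P p -> P q -> P (p * q)) -> forall p, P p.
Proof.
move=> PC PX PD PM p; rewrite [p]mpolyE.
elim/big_ind: _ => [|p1 p2|m _]; [by rewrite -mpolyC0 | exact: PD |].
rewrite -mul_mpolyC mpolyXE_id; apply: (PM) => //.
elim/big_ind: _ => [|p1 p2|i _]; [by rewrite -mpolyC1 | exact: PM |].
by elim: (m i) => [|k IH]; rewrite ?expr0 -?mpolyC1 ?exprS //; exact: PM.
Qed.

Lemma poly_eval_eq (K : numFieldType) (p q : {poly K}) :
  (forall t, p.[t] = q.[t]) -> p = q.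
Proof.
move=> E; apply/eqP; rewrite -subr_eq0; apply/negPn/negP => pq0.
have inj : injective (fun i : nat => (i%:R : K)).
  by move=> i j /eqP; rewrite eqr_nat => /eqP.
have := @max_poly_roots _ (p - q) [seq i%:R | i <- iota 0 (size (p - q))] pq0.
rewrite size_map size_iota ltnn => H; apply: notF; apply: H.
  by apply/allP => x _; rewrite /root !hornerE E subrr.
by rewrite map_inj_uniq ?iota_uniq.
Qed.

Section LinePoly.
Variables (K : numFieldType) (n : nat).
Implicit Types (p q : {mpoly K[n]}) (v w : 'I_n -> K).

Definition line_poly p v w : {poly K} :=
  mmap (@polyC K) (fun i => (v i)%:P + w i *: 'X) p.

Lemma line_polyM p q v w :
  line_poly (p * q) v w = line_poly p v w * line_poly q v w.
Proof.
by apply: (mmap_is_multiplicative _ _).1 => *; rewrite /GRing.comm mulrC.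
Qed.

Lemma line_polyX i v w : line_poly 'X_i v w = (v i)%:P + w i *: 'X.
Proof. by rewrite /line_poly mmapX mmap1U. Qed.

Lemma horner_line_poly p v w t :
  (line_poly p v w).[t] = p.@[fun i => v i + t * w i].
Proof.
elim/mpoly_ring_ind: p => [c|i|p q IHp IHq|p q IHp IHq].
- by rewrite /line_poly mmapC hornerC mevalC.
- by rewrite line_polyX mevalXU !hornerE mulrC.
- by rewrite /line_poly mmapD hornerD IHp IHq mevalD.
- by rewrite line_polyM hornerM IHp IHq mevalM.
Qed.

(** The chain rule. *)
Lemma deriv_line_poly p v w :
  (line_poly p v w)^`() = \sum_i w i *: line_poly p^`M(i) v w.
Proof.
elim/mpoly_ring_ind: p => [c|j|p q IHp IHq|p q IHp IHq].
- rewrite /line_poly mmapC derivC big1 // => i _.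
  by rewrite mderivC mmap0 scaler0.
- rewrite line_polyX !derivE add0r (bigD1 j) //= big1 ?addr0.
    rewrite mderivX mnm1E eqxx scale1r.
    have -> : (U_(j) - U_(j))%MM = 0%MM :> 'X_{1..n}.
      by apply/mnmP => l; rewrite mnmBE subnn mnm0E.
    rewrite mpolyX0.
    by rewrite -mpolyC1 /line_poly mmapC alg_polyC.
  move=> i ij; rewrite mderivX mnm1E eq_sym (negPf ij) scale0r /line_poly.
  by rewrite mmap0 scaler0.
- rewrite {1}/line_poly mmapD derivD IHp IHq -big_split; apply: eq_bigr => i _.
  by rewrite mderivD /line_poly mmapD scalerDr.
- rewrite line_polyM derivM IHp IHq mulr_suml mulr_sumr -big_split.
  apply: eq_bigr => i _ /=; rewrite mderivM [in RHS]/line_poly mmapD.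
  by rewrite -!/(line_poly _ _ _) !line_polyM scalerDr -scalerAl -scalerAr.
Qed.

(** In characteristic 0 the partial derivatives of a polynomial that vanishes
    everywhere vanish everywhere too.  By induction on the degree they are zero,
    so the polynomial is constant. *)
Lemma mpoly_eval0 p : (forall v, p.@[v] = 0) -> p = 0.
Proof.
move: {2}(msize p) (leqnn (msize p)) => k.
elim: k p => [|k IH] p; first by rewrite leqn0 msize_poly_eq0 => /eqP.
move=> sz_p p0.
(* A partial derivative at v is the derivative at 0 of p along a line. *)
have D0 i : p^`M(i) = 0.
  apply: IH.
    rewrite mmeasureE; apply/bigmax_leqP_seq => m.
    rewrite mcoeff_msupp mcoeff_deriv => nz _.
    have : (m + U_(i))%MM \in msupp p.
      by rewrite mcoeff_msupp; apply: contraNneq nz => ->; rewrite mul0rn.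
    by move/msize_mdeg_lt; rewrite mdegD mdeg1 addn1 => /leq_trans/(_ sz_p).
  move=> v; pose w j : K := (j == i)%:R.
  have lp0 : line_poly p v w = 0.
    by apply: poly_eval_eq => t; rewrite horner_line_poly p0 horner0.
  have := deriv_line_poly p v w; rewrite lp0 deriv0 (bigD1 i) //= big1.
    rewrite addr0 /w eqxx scale1r => /(congr1 (fun q : {poly K} => q.[0])).
    rewrite horner0 horner_line_poly => E; rewrite [RHS]E.
    by apply: meval_eq => j; rewrite mul0r addr0.
  by move=> j ji; rewrite /w (negPf ji) scale0r.
have Ep : p = (p@_0)%:MP.
  apply/mpolyP => m; rewrite mcoeffC; case: eqVneq => [<-|m0].
    by rewrite mulr1.
  rewrite mulr0; have [i mi] : exists i, m i != 0%N.
    apply/existsP; apply: contra_neqT m0; rewrite negb_exists => /forallP m0.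
    by apply/mnmP => i; rewrite mnm0E; move: (m0 i); rewrite negbK => /eqP.
  have := congr1 (mcoeff (m - U_(i))%MM) (D0 i).
  rewrite mcoeff_deriv submK ?lep1mP // mcoeff0 => /eqP.
  by rewrite mulrn_eq0 => /eqP.
have := p0 (fun=> 0); rewrite {1}Ep mevalC => c0.
by rewrite Ep c0 mpolyC0.
Qed.

End LinePoly.

(** * The affine coordinate ring of a Weierstrass cubic *)

Section CoordRing.
Variable B : comNzRingType.

(** The ring B[y] / (y^2 - h), a pair (a, b) standing for a + b y. *)
Definition coordring (h : B) := (B * B)%type.
Variable h : B.
Local Notation A := (coordring h).

HB.instance Definition _ := GRing.Zmodule.copy A (B * B)%type.

Definition coord_one : A := (1, 0).
Definition coord_mul (f g : A) : A :=
  (f.1 * g.1 + f.2 * g.2 * h, f.1 * g.2 + f.2 * g.1).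

Fact coord_mulA : associative coord_mul.
Proof. by move=> [a b] [c d] [e f]; congr pair => /=; ring. Qed.
Fact coord_mulC : commutative coord_mul.
Proof. by move=> [a b] [c d]; congr pair => /=; ring. Qed.
Fact coord_mul1 : left_id coord_one coord_mul.
Proof. by move=> [a b]; congr pair => /=; ring. Qed.
Fact coord_mulD : left_distributive coord_mul +%R.
Proof. by move=> [a b] [c d] [e f]; congr pair => /=; ring. Qed.
Fact coord_one_neq0 : coord_one != 0.
Proof. by apply/eqP => -[] /eqP; rewrite oner_eq0. Qed.

HB.instance Definition _ := GRing.Zmodule_isComNzRing.Build A
  coord_mulA coord_mulC coord_mul1 coord_mulD coord_one_neq0.

Lemma coordD (f g : A) : f + g = (f.1 + g.1, f.2 + g.2). Proof. by []. Qed.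
Lemma coordM (f g : A) :
  f * g = (f.1 * g.1 + f.2 * g.2 * h, f.1 * g.2 + f.2 * g.1).
Proof. by []. Qed.

Definition norm (f : A) : B := f.1 ^+ 2 - f.2 ^+ 2 * h.
Definition conjr (f : A) : A := (f.1, - f.2).

Lemma normM f g : norm (f * g) = norm f * norm g.
Proof. by rewrite coordM /norm /=; ring. Qed.

Lemma mulr_conjr f : f * conjr f = (norm f, 0).
Proof. by rewrite coordM /norm /=; congr pair; ring. Qed.

End CoordRing.

Section Ideals.
Variable A : comNzRingType.

Definition ideal2 (a b g : A) := exists r s, g = r * a + s * b.

(** The k-th power of the ideal generated by a and b. *)
Fixpoint ideal_pow (a b : A) k g : Prop :=
  if k is k'.+1 then
    exists r s, [/\ ideal_pow a b k' r, ideal_pow a b k' s & g = r * a + s * b]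
  else True.

Lemma ideal_powD a b k g g' :
  ideal_pow a b k g -> ideal_pow a b k g' -> ideal_pow a b k (g + g').
Proof.
elim: k g g' => //= k IH g g' [r [s [hr hs ->]]] [r' [s' [hr' hs' ->]]].
by exists (r + r'), (s + s'); split; [exact: IH | exact: IH | ring].
Qed.

Lemma ideal_powMl a b k r g : ideal_pow a b k g -> ideal_pow a b k (r * g).
Proof.
elim: k g => //= k IH g [u [v [hu hv ->]]].
by exists (r * u), (r * v); split; [exact: IH | exact: IH | ring].
Qed.

Lemma ideal_powX a b k g : ideal2 a b g -> ideal_pow a b k (g ^+ k).
Proof.
move=> [r [s E]]; elim: k => //= k IH.
exists (r * g ^+ k), (s * g ^+ k); split; try exact: ideal_powMl.
by rewrite exprS {1}E; ring.
Qed.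

Lemma ideal2l a b : ideal2 a b a.
Proof. by exists 1, 0; ring. Qed.

(** The hypothesis says that f' is invertible modulo the ideal, hence modulo
    its powers: 1 = w f' + v with v in the k-th power, and
    f = w (f f') + f v. *)
Lemma ideal_pow_unit a b k f f' u :
  ideal2 a b (u * f' - 1) -> ideal_pow a b k (f * f') -> ideal_pow a b k f.
Proof.
move=> /(@ideal_powX _ _ k) hv hff.
have [w hw] : exists w, (1 - (u * f' - 1 + 1)) ^+ k = 1 - w * f'.
  elim: k {hv hff} => [|k [w IH]]; first by exists 0; rewrite expr0; ring.
  by rewrite exprS IH; exists (w + u - u * w * f'); ring.
have -> : f = w * (f * f') + (-1) ^+ k * f * (u * f' - 1) ^+ k.
  have -> : (-1) ^+ k * f * (u * f' - 1) ^+ k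
          = f * (1 - (u * f' - 1 + 1)) ^+ k.
    have -> : 1 - (u * f' - 1 + 1) = (-1) * (u * f' - 1) by ring.
    by rewrite exprMn; ring.
  by rewrite hw; ring.
by apply: ideal_powD; apply: ideal_powMl.
Qed.

(** The relation between three collinear points, in ideals.  Read l as the
    equation y - m x - n of a line through T, p and R, read XT, Xp and XR as the
    differences between x and the abscissas of these points, and Y' as
    y - y(T'), where T' is the opposite of R.  Then l + m XT is y - y(T), and
    the hypothesis expresses that the product of l and its conjugate is its norm.
    The conclusion is that XR times the product of the ideals of T and p is
    contained in l times the ideal of T'. *)
Lemma line_step (l m XT Xp XR Y' : A) g1 g2 :
  l * (Y' + m * XR) = XT * Xp * XR ->
  ideal2 XT (l + m * XT) g1 -> ideal2 XT (l + m * XT) g2 ->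
  exists2 g, ideal2 XR Y' g & XR * (g1 * Xp + g2 * (l + m * Xp)) = l * g.
Proof.
move=> E [r1 [s1 ->]] [r2 [s2 ->]].
(* W is the conjugate of l, up to sign. *)
set W := Y' + m * XR in E.
exists (r1 * W + s1 * (Xp * XR + m * W) + r2 * (XT * XR + m * W)
        + s2 * ((l + m * XT + m * Xp) * XR + m ^+ 2 * W)).
  exists (r1 * m + s1 * (Xp + m * m) + r2 * (XT + m * m)
        + s2 * ((l + m * XT + m * Xp) + m ^+ 2 * m)),
    (r1 + s1 * m + r2 * m + s2 * m ^+ 2).
  by rewrite /W; ring.
have -> : XR * ((r1 * XT + s1 * (l + m * XT)) * Xp
    + (r2 * XT + s2 * (l + m * XT)) * (l + m * Xp)) =
   (r1 + s1 * m + r2 * m + s2 * m ^+ 2) * (XT * Xp * XR)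
  + l * (s1 * Xp * XR + r2 * XT * XR + s2 * (l + m * XT + m * Xp) * XR)
  by ring.
by rewrite -E; ring.
Qed.

End Ideals.

Section NormSize.
Variable K : fieldType.
Variable h : {poly K}.
Hypothesis size_h : size h = 4%N.
Local Notation A := (coordring h).

(** The sizes of a^2 and of b^2 h cannot cancel, one being odd and the other
    even. *)
Lemma size_norm (f : A) :
  size (norm f) =
    maxn (if f.1 == 0 then 0%N else (size f.1).*2.-1)
         (if f.2 == 0 then 0%N else (size f.2).*2.+2).
Proof.
case: f => a b; rewrite /norm /=.
have h0 : h != 0 by rewrite -size_poly_eq0 size_h.
have sa : size (a ^+ 2) = (if a == 0 then 0%N else (size a).*2.-1).
  case: eqVneq => [->|a0]; first by rewrite expr0n size_poly0.
  by rewrite expr2 size_mul // addnn.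
have sb : size (b ^+ 2 * h) = (if b == 0 then 0%N else (size b).*2.+2).
  case: eqVneq => [->|b0]; first by rewrite expr0n mul0r size_poly0.
  rewrite expr2 size_mul ?mulf_neq0 // size_mul // size_h addnn.
  move: b0; rewrite -size_poly_gt0; case: (size b) => // n _.
  by rewrite doubleS !addnS addn0.
have odd_sa : a != 0 -> odd (size (a ^+ 2)).
  move=> a0; rewrite sa (negPf a0); move: a0; rewrite -size_poly_gt0.
  by case: (size a) => // n _; rewrite doubleS /= odd_double.
have ev_sb : ~~ odd (size (b ^+ 2 * h)).
  by rewrite sb; case: ifP => //= _; rewrite odd_double.
rewrite -sa -sb; case: (eqVneq a 0) => [->|a0].
  by rewrite expr0n sub0r size_polyN size_poly0 max0n.
case: (ltngtP (size (a ^+ 2)) (size (b ^+ 2 * h))) => lt.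
- by rewrite addrC size_polyDl ?size_polyN.
- by rewrite size_polyDl ?size_polyN.
- by move: (odd_sa a0); rewrite lt (negPf ev_sb).
Qed.

Lemma norm_eq0 (f : A) : (norm f == 0) = (f == 0).
Proof.
rewrite -size_poly_eq0 size_norm; case: f => a b /=; rewrite xpair_eqE.
have [_|a0] := eqVneq a 0; have [_|b0] := eqVneq b 0; rewrite ?max0n //=.
  rewrite maxn0; move: a0; rewrite -size_poly_gt0.
  by case: (size a).
rewrite -leqn0 geq_max; move: a0; rewrite -size_poly_gt0.
by case: (size a).
Qed.

(** No function has exactly one affine zero, counted with multiplicity. *)
Lemma size_norm_neq2 (f : A) : size (norm f) != 2%N.
Proof.
rewrite size_norm; case: f => a b /=.
case: (eqVneq a 0) => [_|a0]; case: (eqVneq b 0) => [_|b0] //=.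
- by rewrite max0n; move: b0; rewrite -size_poly_gt0; case: (size b).
- rewrite maxn0; move: a0; rewrite -size_poly_gt0.
  by case: (size a) => [|[|n]] //.
apply/negP => /eqP E.
have : ((size b).*2.+2 <= 2)%N by rewrite -E leq_maxr.
by move: b0; rewrite -size_poly_gt0; case: (size b).
Qed.

Definition deg_norm (f : A) := (size (norm f)).-1.

Lemma coord_mulf_neq0 (f g : A) : f != 0 -> g != 0 -> f * g != 0.
Proof. by rewrite -!norm_eq0 normM => ? ?; rewrite mulf_neq0. Qed.

Lemma deg_normM (f g : A) : f != 0 -> g != 0 ->
  deg_norm (f * g) = (deg_norm f + deg_norm g)%N.
Proof.
rewrite -!norm_eq0 /deg_norm => f0 g0; rewrite normM size_mul //.
rewrite -!subn1; move: f0 g0; rewrite -!size_poly_gt0.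
by case: (size _) => // m; case: (size _) => // n _ _; rewrite addnS !subn1.
Qed.

End NormSize.

(** At a point with y = 0 the function x - a vanishes twice, so that a function
    whose norm is a constant times an odd power of x - a would, after division
    by powers of x - a, have a norm of degree 1. *)
Lemma ramified_norm_odd (K : fieldType) (h : {poly K}) (size_h : size h = 4%N)
    (a k : K) n (f : coordring h) :
  h.[a] = 0 -> h^`().[a] != 0 -> k != 0 ->
  norm f <> k *: ('X - a%:P) ^+ n.*2.+1.
Proof.
move=> ha h'a k0.
have [h1 Eh] : exists h1, h = h1 * ('X - a%:P).
  by apply/factor_theorem; rewrite /root ha.
have h1a : h1.[a] != 0.
  by move: h'a; rewrite Eh derivM derivXsubC !hornerE subrr mulr0 add0r.
have X0 : 'X - a%:P != 0 by rewrite polyXsubC_eq0.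
elim: n f => [|n IH] [p q].
  move=> E; have := size_norm_neq2 size_h (p, q).
  by rewrite E size_scale // size_exp_XsubC.
rewrite /norm /= => E.
have [p1 Ep] : exists p1, p = p1 * ('X - a%:P).
  apply/factor_theorem; rewrite /root.
  have := congr1 (fun r => r.[a]) E.
  rewrite /= hornerD hornerN !hornerM ha mulr0 subr0 hornerZ exprS hornerM.
  rewrite hornerXsubC subrr mul0r mulr0 => /eqP.
  by rewrite mulf_eq0 orbb.
have E1 : p1 ^+ 2 * ('X - a%:P) - q ^+ 2 * h1 = k *: ('X - a%:P) ^+ n.+1.*2.
  apply: (mulIf X0); rewrite -scalerAl -exprSr -E Ep.
  by rewrite [in RHS]Eh; ring.
have [q1 Eq] : exists q1, q = q1 * ('X - a%:P).
  apply/factor_theorem; rewrite /root.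
  have := congr1 (fun r => r.[a]) E1.
  rewrite /= hornerD hornerN !hornerM hornerZ doubleS exprS hornerM.
  rewrite hornerXsubC subrr mul0r !mulr0 add0r => /eqP.
  by rewrite oppr_eq0 mulf_eq0 (negPf h1a) orbF mulf_eq0 orbb.
apply: (IH (p1, q1)); rewrite /norm /=.
apply: (mulIf X0); rewrite -scalerAl -exprSr -doubleS -E1 Eq.
by rewrite [in LHS]Eh; ring.
Qed.

(** * Multiples of a point and powers of its ideal *)

Section Chain.
Variable K : fieldType.
Variable h : {poly K}.
Hypothesis size_h : size h = 4%N.
Local Notation A := (coordring h).

Definition emb (p : {poly K}) : A := (p, 0).
Definition abscissa (a : K) : A := ('X - a%:P, 0).
Definition ordinate (b : K) : A := (- b%:P, 1).

(** [None] is the origin, at infinity, and [Some (x, y)] an affine point. *)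
Definition on_affine (T : option (K * K)) : Prop :=
  if T is Some q then q.2 ^+ 2 = h.[q.1] else True.

(** The ideal of a point; at the origin it is the whole ring, as all affine
    functions have their poles there. *)
Definition vanishing (T : option (K * K)) (g : A) : Prop :=
  if T is Some q then ideal2 (abscissa q.1) (ordinate q.2) g else True.

Definition weight (T : option (K * K)) : nat :=
  if T is Some _ then 1%N else 0%N.

Variables (a b : K).
Hypothesis on_ab : b ^+ 2 = h.[a].

(** Addition of the affine point (a, b).  In the last case the chord, or the
    tangent if x = a, has the equation y = m x + n, and r is the abscissa of its
    third intersection with the curve. *)
Inductive affine_add : option (K * K) -> option (K * K) -> Prop :=
| Add_origin : affine_add None (Some (a, b))
| Add_opp : affine_add (Some (a, - b)) None
| Add_chord m n x r of b = m * a + n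
    & h - (m *: 'X + n%:P) ^+ 2 = ('X - x%:P) * ('X - a%:P) * ('X - r%:P) :
    affine_add (Some (x, m * x + n)) (Some (r, - (m * r + n))).

(** The k-th power of the ideal of (a, b) is contained in the ideal of T, up to
    a principal fractional ideal.  The equation between degrees says that this
    inclusion of ideals is an equality, without computing any of them. *)
Definition equiv_power (k : nat) (T : option (K * K)) : Prop :=
  exists u v : A, [/\ u != 0, v != 0,
    (deg_norm u + k = deg_norm v + weight T)%N &
    forall g, ideal_pow (abscissa a) (ordinate b) k g ->
      exists2 g', vanishing T g' & u * g = v * g'].

Lemma norm_cst (p : {poly K}) : norm (emb p) = p ^+ 2.
Proof. by rewrite /norm /=; ring. Qed.

Lemma abscissa_neq0 c : abscissa c != 0.
Proof. by rewrite xpair_eqE polyXsubC_eq0. Qed.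

Lemma deg_norm_abscissa c : deg_norm (abscissa c) = 2%N.
Proof. by rewrite /deg_norm norm_cst size_exp_XsubC. Qed.

Definition line_fun m n : A := (- (m *: 'X + n%:P), 1).

Lemma line_fun_neq0 m n : line_fun m n != 0.
Proof. by rewrite xpair_eqE oner_eq0 andbF. Qed.

Lemma size_mXnC (m n : K) : (size (m *: 'X + n%:P)%R <= 2)%N.
Proof.
apply: leq_trans (size_polyD _ _) _; rewrite geq_max.
rewrite (leq_trans (size_scale_leq _ _)) ?size_polyX //=.
by rewrite (leq_trans (size_polyC_leq1 _)).
Qed.

Lemma deg_norm_line m n : deg_norm (line_fun m n) = 3%N.
Proof.
rewrite /deg_norm (size_norm size_h) /= oner_eq0 size_poly1 size_polyN.
case: eqP => // _; have := size_mXnC m n.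
by case: (size _) => [|[|[|]]].
Qed.

(** Adding (a, b) to the origin changes nothing but the ideal; adding it to its
    opposite brings in the vertical line x = a; in general the chord y = m x + n
    and the vertical line x = r come in, as in [line_step]. *)
Lemma equiv_power_step k T T' :
  affine_add T T' -> equiv_power k T -> equiv_power k.+1 T'.
Proof.
case=> [|| m n x r Eb Eh] [u [v [u0 v0 Ed Eg]]].
- exists u, v; split=> //.
    by move: Ed => /=; rewrite addnS addn0 addn1 => ->.
  move=> g /= [r [s [/Eg [r' _ Er] /Eg [s' _ Es] ->]]].
  exists (r' * abscissa a + s' * ordinate b); first by exists r', s'.
  by rewrite mulrDr !mulrA Er Es; ring.
- exists u, (v * abscissa a); split=> //.
  + by rewrite (coord_mulf_neq0 size_h) ?abscissa_neq0.
  + rewrite (deg_normM size_h) ?abscissa_neq0 // deg_norm_abscissa addnS Ed /=.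
    by rewrite addn0 addn1 addn2.
  move=> g /= [r [s [/Eg [_ [r1 [r2 ->]] Er] /Eg [_ [s1 [s2 ->]] Es] ->]]].
  have [H EH] : exists H, h - (b ^+ 2)%:P = H * ('X - a%:P).
    by apply/factor_theorem; rewrite /root !hornerE on_ab subrr.
  have EY : ordinate (- b) * ordinate b = emb H * abscissa a.
    rewrite !coordM /= mul0r mul0r addr0 -EH polyCN [in RHS]expr2 polyCM.
    by congr pair; ring.
  exists (r1 * abscissa a + r2 * ordinate (- b) + s1 * ordinate b + s2 * emb H).
    by [].
  rewrite mulrDr !mulrA Er Es.
  transitivity (v * (r1 * abscissa a + r2 * ordinate (- b) + s1 * ordinate b)
                * abscissa a + v * s2 * (ordinate (- b) * ordinate b)).
    by ring.
  by rewrite EY; ring.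
exists (u * abscissa r), (v * line_fun m n); split.
- by rewrite (coord_mulf_neq0 size_h) ?abscissa_neq0.
- by rewrite (coord_mulf_neq0 size_h) ?line_fun_neq0.
- rewrite !(deg_normM size_h) ?abscissa_neq0 ?line_fun_neq0 //.
  by rewrite deg_norm_abscissa deg_norm_line; move: Ed => /=; lia.
move=> g /= [g1 [g2 [/Eg [g1' /= I1 E1] /Eg [g2' /= I2 E2] ->]]].
have chordE c : ordinate (m * c + n) = line_fun m n + emb m%:P * abscissa c.
  rewrite coordM coordD /= !mul0r !mulr0 !addr0; congr pair.
  by rewrite -mul_polyC polyCD polyCM; ring.
rewrite chordE in I1 I2; rewrite Eb chordE.
have El : line_fun m n * (ordinate (- (m * r + n)) + emb m%:P * abscissa r) =
    abscissa x * abscissa a * abscissa r.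
  rewrite !coordM coordD /= !mul0r !mulr0 !addr0 -Eh; congr pair.
    by rewrite -mul_polyC polyCN polyCD polyCM; ring.
  by rewrite -mul_polyC polyCN polyCD polyCM; ring.
have [g' Ig' Eg'] := line_step El I1 I2.
exists g' => //.
transitivity (abscissa r * (u * g1 * abscissa a
   + u * g2 * (line_fun m n + emb m%:P * abscissa a))); first by ring.
rewrite E1 E2.
transitivity (v * (abscissa r * (g1' * abscissa a
   + g2' * (line_fun m n + emb m%:P * abscissa a)))); first by ring.
by rewrite Eg'; ring.
Qed.

Lemma equiv_power0 : equiv_power 0 None.
Proof.
exists 1, 1; split=> //; try exact: oner_neq0.
by move=> g _; exists g.
Qed.

(** Otherwise u f = v g for some g, and the degrees leave 1 for the norm
    of g. *)
Lemma not_principal f k q :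
  ideal_pow (abscissa a) (ordinate b) k f -> deg_norm f = k -> f != 0 ->
  ~ equiv_power k (Some q).
Proof.
move=> If df f0 [u [v [u0 v0 /= Ed /(_ f If) [g _ E]]]].
have g0 : g != 0.
  apply/eqP => g0; move: (coord_mulf_neq0 size_h u0 f0).
  by rewrite E g0 mulr0 eqxx.
have := congr1 (@deg_norm _ _) E; rewrite !(deg_normM size_h) // df Ed.
move/addnI; rewrite /deg_norm => /esym dg; have := size_norm_neq2 size_h g.
by case: (size _) dg => //= n ->.
Qed.

(** The norm is the product of f with its conjugate, and the second hypothesis
    says that the conjugate of f does not vanish at (a, b), so that it is
    invertible modulo the powers of the ideal of this point. *)
Lemma power_of_ideal f c k :
  norm f = c *: ('X - a%:P) ^+ k -> f.1.[a] - f.2.[a] * b != 0 ->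
  ideal_pow (abscissa a) (ordinate b) k f.
Proof.
move=> Nf; set e := f.1.[a] - _ => e0.
apply: (@ideal_pow_unit _ _ _ _ _ (conjr f) (emb e^-1%:P)).
  have [p1 E1] : exists p, f.1 - f.1.[a]%:P = p * ('X - a%:P).
    by apply/factor_theorem; rewrite /root !hornerE subrr.
  have [p2 E2] : exists p, f.2 - f.2.[a]%:P = p * ('X - a%:P).
    by apply/factor_theorem; rewrite /root !hornerE subrr.
  exists ((e^-1 *: p1, - (e^-1 *: p2)) : A), (emb (- (e^-1 * f.2.[a])%:P)).
  rewrite !coordM coordD /= !mul0r !mulr0 !addr0 !add0r; congr pair.
    rewrite -scalerAl -E1 -[LHS]/(e^-1%:P * f.1 - 1) -mul_polyC !polyCM.
    have -> : 1 = e^-1%:P * (f.1.[a]%:P - f.2.[a]%:P * b%:P).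
      by rewrite -polyCM -polyCB -polyCM mulVf.
    by rewrite /=; ring.
  by rewrite /= mulNr -scalerAl -E2 -mul_polyC polyCM; ring.
rewrite mulr_conjr Nf.
have -> : (c *: ('X - a%:P) ^+ k, 0) = emb c%:P * abscissa a ^+ k.
  have -> : abscissa a ^+ k = emb (('X - a%:P) ^+ k).
    elim: k {Nf} => // k IH; rewrite !exprS IH coordM /=.
    by congr pair; ring.
  by rewrite coordM /= -mul_polyC; congr pair; ring.
by apply/ideal_powMl/ideal_powX; exact: ideal2l.
Qed.

(** Substitute the equation of the chord, or of the tangent, in y^2 = h: the
    result is a monic cubic in x with two known roots, which has a third one. *)
Lemma affine_add_exists T :
  h \is monic -> (2%:R : K) != 0 -> b != 0 -> on_affine T ->
  exists2 T', affine_add T T' & on_affine T'.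
Proof.
move=> h_monic two0 b0; case: T => [[x y]|] /= onT; last first.
  by exists (Some (a, b)); first by constructor.
have chord m n : y = m * x + n -> b = m * a + n ->
    (forall q, h - (m *: 'X + n%:P) ^+ 2 = q * ('X - a%:P) -> q.[x] = 0) ->
  exists2 T', affine_add (Some (x, y)) T' & on_affine T'.
  move=> -> Eb root_q.
  have [q Eq] : exists q, h - (m *: 'X + n%:P) ^+ 2 = q * ('X - a%:P).
    by apply/factor_theorem; rewrite /root !hornerE -on_ab Eb subrr.
  have [q2 Eq2] : exists q2, q = q2 * ('X - x%:P).
    by apply/factor_theorem/rootP; apply: root_q.
  have sl : (size (- (m *: 'X + n%:P) ^+ 2)%R < size h)%N.
    rewrite size_polyN size_h; have := size_mXnC m n.
    apply: contraTT; rewrite -leqNgt -ltnNge => lt; rewrite expr2 in lt.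
    have := leq_trans lt (size_polyMleq _ _).
    by case: (size _) => [|[|[|]]].
  have mon : h - (m *: 'X + n%:P) ^+ 2 \is monic.
    by rewrite monicE lead_coefDl // (eqP h_monic).
  have szq : size (h - (m *: 'X + n%:P) ^+ 2) = 4%N by rewrite size_polyDl.
  have q2m : q2 \is monic.
    by move: mon; rewrite Eq Eq2 !monicMr ?monicXsubC.
  have sq2 : size q2 = 2%N.
    move: szq; rewrite Eq Eq2.
    rewrite !size_mul ?mulf_neq0 ?polyXsubC_eq0 ?monic_neq0 //.
    by rewrite !size_XsubC !addnS !addn0 /= => -[].
  have [r Er] : exists r, q2 = 'X - r%:P.
    exists (- q2`_0); apply/polyP => i; rewrite polyCN opprK coefD coefX coefC.
    case: i => [|[|i]] /=; rewrite ?add0r ?addr0 //.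
      by move: q2m; rewrite monicE lead_coefE sq2 => /eqP.
    by rewrite nth_default ?sq2.
  have Efact : h - (m *: 'X + n%:P) ^+ 2
      = ('X - x%:P) * ('X - a%:P) * ('X - r%:P).
    by rewrite Eq Eq2 Er; ring.
  exists (Some (r, - (m * r + n))); first by constructor.
  have := congr1 (fun p => p.[r]) Efact; rewrite /= !hornerE subrr mulr0 sqrrN.
  by move/subr0_eq.
(* If the abscissas are equal, then either the points are opposite, or they are
   equal and m is the slope of the tangent. *)
case: (eqVneq x a) => [Ex|xa].
  subst x; have : (y - b) * (y + b) = 0.
    by rewrite -subr_sqr onT on_ab subrr.
  move/eqP; rewrite mulf_eq0 => /orP[|]; last first.
    by rewrite addr_eq0 => /eqP ->; exists None; first by constructor.
  rewrite subr_eq0 => /eqP Ey; subst y.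
  have [m Em] : exists m, h^`().[a] = m * (2%:R * b).
    by exists (h^`().[a] / (2%:R * b)); rewrite divfK // mulf_neq0.
  apply: (chord m (b - m * a)); [ring|ring|] => q Eq.
  have := congr1 (fun p => p^`().[a]) Eq.
  rewrite /= !derivE !hornerE /= subrr mulr0 add0r Em => <-.
  ring.
have [m Em] : exists m, m * (x - a) = y - b.
  by exists ((y - b) / (x - a)); rewrite divfK // subr_eq0.
have yE : y = m * x + (b - m * a).
  have : y = m * (x - a) + b by rewrite Em; ring.
  by move=> {1}->; ring.
apply: (chord m (b - m * a)) => //; first by ring.
move=> q /(congr1 (fun p => p.[x])).
rewrite hornerD hornerN horner_exp.
rewrite !(hornerD, hornerZ, hornerX, hornerC, hornerM, hornerN) -yE onT subrr.
by move/esym/eqP; rewrite mulf_eq0 subr_eq0 (negPf xa) orbF => /eqP.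
Qed.

End Chain.

(** * Points, lines and plane curves *)

Lemma mem_seq3 (T : eqType) (a b c : T) :
  [/\ a \in [:: a; b; c], b \in [:: a; b; c] & c \in [:: a; b; c]].
Proof. by rewrite !inE !eqxx !orbT. Qed.

Lemma count_seq3 (T : eqType) (a b c : T) : count_mem c [:: a; b; c] =
  ((a == c) + (b == c) + 1)%N.
Proof. by rewrite /= eqxx addn0 addnA. Qed.

Section Points.
Variable K : numFieldType.
Local Notation vec := 'rV[K]_3.
Local Notation pt := (point K).

Definition coord_vec (x : pt) : vec := vpick (val x).

Lemma coord_vec_neq0 x : coord_vec x != 0.
Proof.
rewrite vpick0; apply/eqP => x0; have := valP x.
by rewrite /= -/(val x) x0 dimv0.
Qed.

Lemma point_vline x : val x = <[coord_vec x]>%VS.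
Proof.
apply/esym/eqP; rewrite eqEdim dim_vline coord_vec_neq0 (eqP (valP x)) leqnn.
by rewrite andbT -memvE memv_pick.
Qed.

Lemma vline_point (v : vec) : v != 0 -> exists x : pt, val x = <[v]>%VS.
Proof.
move=> v0; have d1 : \dim <[v]> == 1%N by rewrite dim_vline v0.
by exists (exist _ <[v]>%VS d1).
Qed.

Definition independent (v w : vec) :=
  forall a b : K, a *: v + b *: w = 0 -> a = 0 /\ b = 0.

Lemma vline_eqE v w a b a' b' : independent v w ->
  (a, b) != (0, 0) -> (a', b') != (0, 0) ->
  (<[a *: v + b *: w]> == <[a' *: v + b' *: w]>)%VS = (a * b' == b * a').
Proof.
move=> fvw ab ab'.
have nz c d : (c, d) != (0, 0) -> c *: v + d *: w != 0.
  by apply: contra_neq => /fvw [-> ->].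
apply/idP/eqP => [/eqP E|E].
  have : a *: v + b *: w \in <[a' *: v + b' *: w]>%VS by rewrite -E memv_line.
  move=> /vlineP [k /eqP].
  rewrite -subr_eq0 scalerDr !scalerA opprD addrACA -!scalerBl => /eqP/fvw[].
  by move=> /subr0_eq -> /subr0_eq ->; ring.
suff le : (<[a *: v + b *: w]> <= <[a' *: v + b' *: w]>)%VS.
  by rewrite eqEdim le !dim_vline !nz.
rewrite -memvE; apply/vlineP.
move: ab'; rewrite xpair_eqE negb_and => /orP[a0|b0].
  exists (a / a'); rewrite scalerDr !scalerA divfK //; congr (_ + _ *: _).
  by apply: (mulIf a0); rewrite -E mulrAC divfK.
exists (b / b'); rewrite scalerDr !scalerA divfK //; congr (_ *: _ + _).
by apply: (mulIf b0); rewrite E mulrAC divfK.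
Qed.

Lemma dim_independent v w : independent v w -> \dim (<[v]> + <[w]>) = 2%N.
Proof.
move=> fvw; have v0 : v != 0.
  apply/eqP => v0; have [|/eqP] := fvw 1 0.
    by rewrite v0 scaler0 scale0r addr0.
  by rewrite oner_eq0.
have w0 : w != 0.
  apply/eqP => w0; have [|_ /eqP] := fvw 0 1.
    by rewrite w0 scaler0 scale0r addr0.
  by rewrite oner_eq0.
rewrite dimv_disjoint_sum ?dim_vline ?v0 ?w0 //.
apply/eqP; rewrite -subv0; apply/subvP => u.
move=> /memv_capP[/vlineP[k ->] /vlineP[l E]].
have [] := fvw k (- l).
  by rewrite E scaleNr subrr.
by move=> -> _; rewrite scale0r mem0v.
Qed.

Section Line.
Variables (L : {vspace vec}) (x : pt).
Hypotheses (dimL : \dim L = 2%N) (xL : (val x <= L)%VS).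

Definition second_vec := vpick (L :\: val x)%VS.

Lemma second_vec_neq0 : second_vec != 0.
Proof.
rewrite vpick0 diffv_eq0; apply/negP => /dimvS.
by rewrite dimL (eqP (valP x)).
Qed.

Lemma second_vec_notin : second_vec \notin val x.
Proof.
apply: contra second_vec_neq0 => mem; rewrite -memv0 -(capv_diff L (val x)).
by rewrite memv_cap memv_pick.
Qed.

Lemma line_independent : independent (coord_vec x) second_vec.
Proof.
move=> a b E; have b0 : b = 0.
  apply/eqP; apply: contraNT second_vec_notin => b0.
  have -> : second_vec = (- (b^-1 * a)) *: coord_vec x.
    apply: (scalerI b0); rewrite scalerA mulrN mulVKf // scaleNr.
    by apply/eqP; rewrite -addr_eq0 addrC E.
  by rewrite point_vline memvZ ?memv_line.
move: E; rewrite b0 scale0r addr0 => /eqP.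
by rewrite scaler_eq0 (negPf (coord_vec_neq0 x)) orbF => /eqP.
Qed.

Lemma line_span : L = (<[coord_vec x]> + <[second_vec]>)%VS.
Proof.
apply/esym/eqP.
rewrite eqEdim (dim_independent line_independent) dimL leqnn andbT.
rewrite subv_add -point_vline xL -memvE.
exact: subvP (diffvSl _ _) _ (memv_pick _).
Qed.

End Line.

Lemma horner_restr d (F : ternary_form K d) v w t :
  (restr F v w).[t] = evalv F (v + t *: w).
Proof.
rewrite [restr F v w]/(line_poly F (v 0) (w 0)) horner_line_poly.
by apply: meval_eq => i; rewrite !mxE.
Qed.

Lemma deriv_restr d (F : ternary_form K d) v w :
  (restr F v w)^`().[0] = (w *m gradient F v) 0 0.
Proof.
rewrite -[restr F v w]/(line_poly F (v 0) (w 0)) deriv_line_poly horner_sum mxE.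
apply: eq_bigr => i _; rewrite hornerZ horner_line_poly mxE; congr (_ * _).
by apply: meval_eq => j; rewrite mul0r addr0.
Qed.

Lemma mul_gradient_eq0 d (F : ternary_form K d) v w :
  (w *m gradient F v == 0) = ((restr F v w)^`().[0] == 0).
Proof.
rewrite deriv_restr; apply/eqP/eqP => [->|E]; first by rewrite mxE.
by apply/matrixP => i j; rewrite !ord1 E mxE.
Qed.

Lemma evalv_homog d (F : ternary_form K d) c v :
  evalv F (c *: v) = c ^+ d * evalv F v.
Proof.
rewrite /evalv !mevalE mulr_sumr big_seq [RHS]big_seq.
apply: eq_bigr => m /(dhomog_mf (dhomog_is_dhomog F)) /= dm.
rewrite mulrCA; congr (_ * _); rewrite -dm mdegE -prodrXr -big_split /=.
by apply: eq_bigr => i _; rewrite mxE exprMn.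
Qed.

Lemma form_eval_eq d (F G : ternary_form K d) :
  (forall v, evalv F v = evalv G v) -> F = G.
Proof.
move=> E; apply/val_inj/eqP; rewrite /= -subr_eq0; apply/eqP/mpoly_eval0 => v.
rewrite mevalB; apply/eqP; rewrite subr_eq0; apply/eqP.
have := E (\row_i v i); rewrite /evalv => {}E.
have ev (H : {mpoly K[3]}) : H.@[v] = H.@[(\row_i v i) 0].
  by apply: meval_eq => i; rewrite mxE.
by rewrite [LHS]ev [RHS]ev.
Qed.

Lemma evalvD d (F G : ternary_form K d) v :
  evalv (F + G) v = evalv F v + evalv G v.
Proof. exact: mevalD. Qed.

Lemma evalvZ d (F : ternary_form K d) c v : evalv (c *: F) v = c * evalv F v.
Proof. exact: mevalZ. Qed.

Lemma evalv_cube (l : ternary_form K 1) v : evalv (cube l) v = evalv l v ^+ 3.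
Proof. exact: rmorphXn. Qed.

Lemma on_curveP d (F : ternary_form K d) (x : pt) v :
  val x = <[v]>%VS -> on_curve F x <-> evalv F v = 0.
Proof.
move=> Ex; split=> [|Fv u]; first by apply; rewrite Ex memv_line.
by rewrite Ex => /vlineP[k ->]; rewrite evalv_homog Fv mulr0.
Qed.

(** The special case of Euler's identity at a point of the curve. *)
Lemma gradient_span d (F : ternary_form K d) v :
  evalv F v = 0 -> v *m gradient F v = 0.
Proof.
move=> Fv; apply/eqP; rewrite mul_gradient_eq0.
have -> : restr F v v = 0.
  apply: poly_eval_eq => t; rewrite horner_restr horner0.
  by rewrite -[X in X + _]scale1r -scalerDl evalv_homog Fv mulr0.
by rewrite deriv0 horner0.
Qed.

Lemma mem_tangent d (F : ternary_form K d) (x : pt) w :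
  (w \in tangent_line F x) = (w *m gradient F (coord_vec x) == 0).
Proof. by rewrite memv_ker lfunE. Qed.

Lemma dim_kernel (g : 'cV[K]_3) : g != 0 ->
  \dim (lker (linfun (mulmxr g : 'rV[K]_3 -> 'rV[K]_1))) = 2%N.
Proof.
move=> g0; set f := linfun _.
have := limg_ker_dim f fullv; rewrite capfv dimvf /dim /= mul1n.
have le1 : (\dim (limg f) <= 1)%N.
  by apply: leq_trans (dimvS (subvf _)) _; rewrite dimvf /dim /= mul1n.
have : \dim (limg f) != 0%N.
  rewrite dimv_eq0; apply: contra_neq g0 => img0.
  apply/matrixP => i j; rewrite (ord1 j).
  have := memv_img f (memvf (delta_mx 0 i)).
  rewrite img0 memv0 lfunE /= => /eqP/matrixP/(_ 0 0).
  by rewrite -rowE mxE => ->; rewrite !mxE.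
by move: le1; case: (\dim _) => [|[|]] // _ _; rewrite addn1 => -[].
Qed.

Lemma dim_tangent d (F : ternary_form K d) (x : pt) :
  smooth_at F x -> \dim (tangent_line F x) = 2%N.
Proof. by move=> [_ g0]; exact: dim_kernel. Qed.

Lemma val_sub_tangent d (F : ternary_form K d) (x : pt) :
  on_curve F x -> (val x <= tangent_line F x)%VS.
Proof.
move=> Fx; rewrite point_vline -memvE mem_tangent gradient_span //.
by apply: Fx; exact: memv_pick.
Qed.

Lemma line_mult_dvd d (F : ternary_form K d) L (x : pt) k :
  (0 < k)%N -> (k <= line_mult F L x)%N ->
  restr F (coord_vec x) (second_vec L x) != 0 /\
  'X^k %| restr F (coord_vec x) (second_vec L x).
Proof.
rewrite /line_mult -/(coord_vec x) -/(second_vec L x); set p := restr _ _ _.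
move=> k0 le; have p0 : p != 0.
  apply: contraTneq le => ->; rewrite -ltnNge; apply: leq_trans k0.
  by rewrite /mup; apply: leq_trans (ltn_ord _) _; rewrite size_poly0.
by split=> //; rewrite mup_geq // subr0 in le.
Qed.

Lemma line_mult_on_curve d (F : ternary_form K d) L (x : pt) :
  (0 < line_mult F L x)%N -> on_curve F x.
Proof.
move=> /(line_mult_dvd (ltn0Sn 0)) [_].
rewrite expr1 -['X]subr0 -polyC0 dvdp_XsubCl.
move=> /rootP; rewrite horner_restr scale0r addr0 => E.
by apply/on_curveP; [exact: point_vline | exact: E].
Qed.

(** If the restriction of F to L has a double root at x, then its derivative
    there vanishes, which puts the direction of L in the kernel of the
    gradient. *)
Lemma line_mult_tangent d (F : ternary_form K d) L (x : pt) :
  smooth_at F x -> \dim L = 2%N -> (val x <= L)%VS -> (1 < line_mult F L x)%N ->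
  L = tangent_line F x.
Proof.
move=> sm dL xL /(line_mult_dvd (ltn0Sn 1)) [_ /dvdpP [q E]].
apply/eqP; rewrite eqEdim dL dim_tangent // leqnn andbT.
rewrite {1}(line_span dL xL) subv_add -point_vline.
rewrite val_sub_tangent; last by case: sm.
rewrite /= -memvE mem_tangent mul_gradient_eq0 E expr2 mulrA derivM derivX.
by rewrite !(hornerE, mulr0, addr0).
Qed.

Lemma mup0_affine (A B : K) : (A, B) != (0, 0) ->
  mup 0 (A%:P + B *: 'X) = (A == 0) :> nat.
Proof.
move=> AB; case: eqVneq => [A0|A0]; last first.
  by rewrite mupNroot // /root !hornerE.
move: AB; rewrite A0 xpair_eqE eqxx /= add0r => B0.
rewrite -mul_polyC mupMr ?rootC //.
by have := mup_XsubCX 1 (0 : K) 0; rewrite subr0 expr1 eqxx.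
Qed.

(** The intersection divisor of a line is read off from a factorization of the
    restricted form: each linear factor contributes one to the multiplicity at
    its zero.  An entry (x, (e, f)) of s is a point x together with its
    coordinates on the line. *)
Lemma line_divisor_of_factorization d (F : ternary_form K d) v w
    (s : seq (pt * (K * K))) c :
  independent v w -> c != 0 ->
  (forall i, i \in s -> i.2 != (0, 0) /\
     val i.1 = <[i.2.1 *: v + i.2.2 *: w]>%VS) ->
  (forall a b, evalv F (a *: v + b *: w)
     = c * \prod_(i <- s) (i.2.2 * a - i.2.1 * b)) ->
  line_divisor F (<[v]> + <[w]>) [seq i.1 | i <- s].
Proof.
move=> fvw c0 Hs EF; split; first exact: dim_independent.
  move=> _ /mapP[i /Hs[_ Ei] ->]; rewrite Ei -memvE.
  by rewrite memv_add // memvZ // memv_line.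
set L := (_ + _)%VS => x xL.
have dL := dim_independent fvw.
have inL u : u \in L -> exists a b, u = a *: v + b *: w.
  by move=> /memv_addP[_ /vlineP[a ->] [_ /vlineP[b ->] ->]]; exists a, b.
have [a [b Ex]] : exists a b, coord_vec x = a *: v + b *: w.
  by apply: inL; apply: subvP xL _ _; exact: memv_pick.
have [a' [b' Ey]] : exists a b, second_vec L x = a *: v + b *: w.
  by apply: inL; exact: subvP (diffvSl _ _) _ (memv_pick _).
(* The change of basis from v, w to the two vectors that parametrise the line
   in the definition of [line_mult]. *)
pose D := a * b' - b * a'.
have D0 : D != 0.
  apply/eqP => D0; have ind := @line_independent L x dL.
  have [] := ind b' (- b).
    rewrite Ex Ey !scalerDr !scalerA addrACA -!scalerDl.
    have -> : b' * a + - b * a' = D by rewrite /D; ring.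
    by rewrite D0 mulrC mulNr mulrC subrr !scale0r addr0.
  move=> b'0 /eqP; rewrite oppr_eq0 => /eqP b0.
  have [] := ind a' (- a).
    by rewrite Ex Ey b'0 b0 !scale0r !addr0 !scalerA mulNr mulrC scaleNr subrr.
  move=> a'0 /eqP; rewrite oppr_eq0 => /eqP a0.
  by have := coord_vec_neq0 x; rewrite Ex a0 b0 !scale0r addr0 eqxx.
have ab0 : (a, b) != (0, 0).
  by apply: contra_neq D0; rewrite /D => -[-> ->]; rewrite !mul0r subrr.
pose f (i : pt * (K * K)) : {poly K} :=
  (i.2.2 * a - i.2.1 * b)%:P + (i.2.2 * a' - i.2.1 * b') *: 'X.
have fi0 i : i \in s ->
    (i.2.2 * a - i.2.1 * b, i.2.2 * a' - i.2.1 * b') != (0, 0).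
  case: i => y [al be] /Hs[/= i0 _]; apply: contra_neq i0.
  move=> -[/subr0_eq E1 /subr0_eq E2].
  have alD : al * D = a * (al * b') - a' * (al * b) by rewrite /D; ring.
  have beD : be * D = b' * (be * a) - b * (be * a') by rewrite /D; ring.
  congr pair; apply: (mulIf D0); rewrite mul0r.
    by rewrite alD -E1 -E2; ring.
  by rewrite beD E1 E2; ring.
rewrite /line_mult -/(coord_vec x) -/(second_vec L x).
have -> : restr F (coord_vec x) (second_vec L x) = c%:P * \prod_(i <- s) f i.
  apply: poly_eval_eq => t; rewrite horner_restr Ex Ey scalerDr !scalerA.
  rewrite addrACA -!scalerDl EF hornerM hornerC horner_prod; congr (_ * _).
  by apply: eq_bigr => i _; rewrite /f !hornerE; ring.
rewrite mupMr ?rootC // count_map.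
have f_mup i : i \in s -> f i != 0 /\ mup 0 (f i) = (i.1 == x) :> nat.
  move=> si; have [i0 Ei] := Hs i si; rewrite /f; split.
    apply: contraNneq (fi0 i si) => E; rewrite xpair_eqE.
    have := congr1 (fun p : {poly K} => p`_0) E.
    have := congr1 (fun p : {poly K} => p`_1) E.
    rewrite /= !coefD !coefC !coefZ !coefX /= mulr1 mulr0 add0r addr0.
    by move=> -> ->; rewrite eqxx.
  rewrite mup0_affine ?fi0 // subr_eq0 -val_eqE Ei (point_vline x) Ex.
  by rewrite vline_eqE -?surjective_pairing // eq_sym.
elim: s f_mup {Hs EF fi0} => [|i s IH] f_mup.
  by rewrite big_nil mupNroot ?root1.
have [fi0 fi] := f_mup i (mem_head _ _).
have f_mup' j : j \in s -> f j != 0 /\ mup 0 (f j) = (j.1 == x) :> nat.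
  by move=> sj; apply: f_mup; rewrite inE sj orbT.
rewrite big_cons mupM //=; first by rewrite fi IH.
by rewrite prodf_seq_neq0; apply/allP => j /f_mup'[-> _]; rewrite implybT.
Qed.

Lemma line_divisor_unique d (F : ternary_form K d) L P Q R R' :
  line_divisor F L [:: P; Q; R] -> line_divisor F L [:: P; Q; R'] -> R = R'.
Proof.
move=> [_ inL mL] [_ _ mL'].
have [_ _ R3] := mem_seq3 P Q R.
have RL := inL _ R3.
have E : count_mem R [:: P; Q; R'] = count_mem R [:: P; Q; R].
  exact: etrans (esym (mL' _ RL)) (mL _ RL).
move: E; rewrite count_seq3 /= addn0 addnA => /addnI.
by case: (R' =P R) => // ->.
Qed.

(** A line is determined by two of its intersections with a smooth cubic, even
    if these coincide. *)
Lemma line_divisor_line (F : ternary_form K 3) L P Q R :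
  smooth_curve F -> line_divisor F L [:: P; Q; R] ->
  [/\ on_curve F P, on_curve F Q, on_curve F R &
   L = if P == Q then tangent_line F P else (val P + val Q)%VS].
Proof.
move=> sm [dL inL mL].
have on x : x \in [:: P; Q; R] -> on_curve F x.
  move=> xs; apply: (@line_mult_on_curve _ F L).
  rewrite (mL _ (inL _ xs)) -has_count; apply/hasP; exists x => //.
  exact: eqxx.
have [P3 Q3 R3] := mem_seq3 P Q R.
split; [exact: on | exact: on | exact: on |].
have PL := inL _ P3; have QL := inL _ Q3.
case: eqVneq => [PQ|PQ].
  apply: (line_mult_tangent _ dL PL); first exact/sm/on.
  by rewrite (mL _ PL) -PQ /= eqxx.
apply/esym/eqP; rewrite eqEdim subv_add PL QL dL dimv_disjoint_sum.
  by rewrite (eqP (valP P)) (eqP (valP Q)).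
apply/eqP; rewrite -dimv_eq0; apply: contraNT PQ => nz; rewrite -val_eqE.
have le1 := dimvS (capvSl (val P) (val Q)).
have le2 := dimvS (capvSr (val P) (val Q)).
have E1 : (val P :&: val Q)%VS == val P.
  by rewrite eqEdim capvSl (eqP (valP P)) lt0n.
have E2 : (val P :&: val Q)%VS == val Q.
  by rewrite eqEdim capvSr (eqP (valP Q)) lt0n.
by rewrite -(eqP E1) (eqP E2).
Qed.

Lemma third_point_unique (F : ternary_form K 3) P Q R R' :
  smooth_curve F -> third_point F P Q R -> third_point F P Q R' -> R = R'.
Proof.
move=> sm [L D] [L' D'].
have [_ _ _ EL] := line_divisor_line sm D.
have [_ _ _ EL'] := line_divisor_line sm D'.
by move: D'; rewrite EL' -EL; exact: line_divisor_unique.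
Qed.

Lemma third_point_perm (F : ternary_form K 3) P Q R P' Q' R' :
  perm_eq [:: P; Q; R] [:: P'; Q'; R'] ->
  third_point F P Q R -> third_point F P' Q' R'.
Proof.
move=> ps [L [dL inL mL]]; exists L; split=> [//|x xs|x xL].
  by apply: inL; rewrite (perm_mem ps).
exact: etrans (mL x xL) (permP ps _).
Qed.

Lemma third_point_rot (F : ternary_form K 3) P Q R :
  third_point F P Q R -> third_point F Q R P.
Proof. exact/third_point_perm/permEl/(perm_catC [:: _] [:: _; _]). Qed.

Lemma third_point_swap (F : ternary_form K 3) P Q R :
  third_point F P Q R -> third_point F P R Q.
Proof.
apply: third_point_perm; rewrite perm_cons.
exact/permEl/(perm_catC [:: _] [:: _]).
Qed.

End Points.

Lemma linear_form (K : numFieldType) (g : 'cV[K]_3) :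
  exists l : ternary_form K 1, forall w, evalv l w = (w *m g) 0 0.
Proof.
have hom : \sum_i g i 0 *: 'X_i \is 1.-homog.
  by apply: rpred_sum => i _; apply: rpredZ; rewrite dhomogX /= mdeg1.
exists (DHomog hom) => w; rewrite /evalv /= raddf_sum mxE.
by apply: eq_bigr => i _ /=; rewrite mevalZ mevalXU mulrC.
Qed.

(** * Weierstrass coordinates at a flex *)

Section Coordinates.
Variable K : numFieldType.
Local Notation vec := 'rV[K]_3.

Definition cubic_eval (c : nat -> K) (x y z : K) : K :=
  c 0%N * x ^+ 3 + c 1%N * x ^+ 2 * y + c 2%N * x ^+ 2 * z + c 3%N * x * y ^+ 2
  + c 4%N * x * y * z + c 5%N * x * z ^+ 2 + c 6%N * y ^+ 3
  + c 7%N * y ^+ 2 * z + c 8%N * y * z ^+ 2 + c 9%N * z ^+ 3.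

(** Being a cubic form in x, y and z, as a property of functions. *)
Definition is_cubic (f : K -> K -> K -> K) :=
  exists c, forall x y z, f x y z = cubic_eval c x y z.

Definition comb (u1 u2 u3 : vec) (x y z : K) := x *: u1 + y *: u2 + z *: u3.

Lemma is_cubic_prod (p q : 'I_3 -> K * K * K) (i j k : 'I_3)
    (l := fun i x y z => (p i).1.1 * x + (p i).1.2 * y + (p i).2 * z) :
  is_cubic (fun x y z => l i x y z * l j x y z * l k x y z).
Proof.
rewrite /l; case: (p i) => [[a b] c]; case: (p j) => [[a' b'] c'].
case: (p k) => [[a2 b2] c2] /=.
exists (nth 0 [:: a * a' * a2;
   a * a' * b2 + a * b' * a2 + b * a' * a2;
   a * a' * c2 + a * c' * a2 + c * a' * a2;
   a * b' * b2 + b * a' * b2 + b * b' * a2;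
   a * b' * c2 + a * c' * b2 + b * a' * c2 + b * c' * a2 + c * a' * b2
     + c * b' * a2;
   a * c' * c2 + c * a' * c2 + c * c' * a2;
   b * b' * b2;
   b * b' * c2 + b * c' * b2 + c * b' * b2;
   b * c' * c2 + c * b' * c2 + c * c' * b2;
   c * c' * c2]).
by move=> x y z; rewrite /cubic_eval /=; ring.
Qed.

Lemma monomial3 (m : 'X_{1..3}) : mdeg m = 3%N ->
  exists i j k : 'I_3, forall v : 'I_3 -> K,
    \prod_(s < 3) v s ^+ m s = v i * v j * v k.
Proof.
rewrite mdegE !big_ord_recl big_ord0 => E.
suff [i [j [k H]]] : exists i j k : 'I_3, forall v : 'I_3 -> K,
  v ord0 ^+ m ord0 * (v (lift ord0 ord0) ^+ m (lift ord0 ord0)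
    * (v (lift ord0 (lift ord0 ord0)) ^+ m (lift ord0 (lift ord0 ord0)) * 1))
  = v i * v j * v k.
  by exists i, j, k => v; rewrite !big_ord_recl big_ord0.
move: E; set i0 := ord0; set i1 := lift _ _; set i2 := lift _ _.
move: (m i0) (m i1) (m i2) => [|[|[|[|a]]]] [|[|[|[|b]]]] [|[|[|[|c]]]] //= _.
- by exists i2, i2, i2 => v; ring.
- by exists i1, i2, i2 => v; ring.
- by exists i1, i1, i2 => v; ring.
- by exists i1, i1, i1 => v; ring.
- by exists i0, i2, i2 => v; ring.
- by exists i0, i1, i2 => v; ring.
- by exists i0, i1, i1 => v; ring.
- by exists i0, i0, i2 => v; ring.
- by exists i0, i0, i1 => v; ring.
- by exists i0, i0, i0 => v; ring.
Qed.

Lemma cubic_coefs (F : ternary_form K 3) u1 u2 u3 :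
  is_cubic (fun x y z => evalv F (comb u1 u2 u3 x y z)).
Proof.
suff [c Hc] : is_cubic (fun x y z => \sum_(m <- msupp F)
     F@_m * \prod_i (comb u1 u2 u3 x y z) 0 i ^+ m i).
  by exists c => x y z; rewrite -Hc /evalv mevalE.
have : forall m, m \in msupp F -> mdeg m = 3%N.
  exact: dhomog_mf (dhomog_is_dhomog F).
elim: (msupp F : seq _) => [|m s IH] deg3.
  exists (fun=> 0) => x y z; rewrite big_nil /cubic_eval; ring.
have [c Hc] := IH (fun m' ms => deg3 m' (mem_behead (s := m :: s) ms)).
have [i [j [k E]]] := monomial3 (deg3 m (mem_head _ _)).
pose p i := (u1 0 i, u2 0 i, u3 0 i).
have [c' Hc'] := is_cubic_prod p p i j k.
exists (fun n => F@_m * c' n + c n) => x y z; rewrite big_cons Hc.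
have -> : \prod_i (comb u1 u2 u3 x y z) 0 i ^+ m i = cubic_eval c' x y z.
  by rewrite E -Hc' /comb !mxE /=; ring.
by rewrite /cubic_eval; ring.
Qed.

Definition frame (u1 u2 u3 : vec) :=
  (forall v, exists x y z, v = comb u1 u2 u3 x y z) /\
  (forall x y z, comb u1 u2 u3 x y z = 0 -> [/\ x = 0, y = 0 & z = 0]).

Lemma frame_of_plane u1 u2 u3 : independent u2 u1 ->
  u3 \notin (<[u2]> + <[u1]>)%VS -> frame u1 u2 u3.
Proof.
move=> ind u3N; split=> [v|x y z E]; last first.
  have z0 : z = 0.
    apply/eqP; apply: contraNT u3N => z0.
    have -> : u3 = - (z^-1 * y) *: u2 + (- (z^-1 * x)) *: u1.
      apply: (scalerI z0); rewrite scalerDr !scalerA !mulrN !mulVKf // !scaleNr.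
      rewrite -opprD; apply/eqP; rewrite -addr_eq0 addrC [y *: _ + _]addrC.
      by rewrite -/(comb _ _ _ _ _ _) E.
    by rewrite memv_add // memvZ // memv_line.
  move: E; rewrite /comb z0 scale0r addr0 addrC => /ind[-> ->].
  by [].
have dL := dim_independent ind.
have full : (<[u2]> + <[u1]> + <[u3]>)%VS = fullv.
  apply/eqP; rewrite eqEdim subvf dimvf /dim /= mul1n.
  rewrite dimv_disjoint_sum ?dL ?dim_vline.
    by case: eqP u3N => // ->; rewrite mem0v.
  apply/eqP; rewrite -subv0; apply/subvP => u /memv_capP[uL /vlineP[k E]].
  have [k0|k0] := eqVneq k 0; first by rewrite E k0 scale0r mem0v.
  case/negP: u3N; rewrite -[u3]scale1r -(mulVf k0) -scalerA -E.
  exact: memvZ.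
have := memvf v; rewrite -full.
move=> /memv_addP[u /memv_addP[_ /vlineP[y ->] [_ /vlineP[x ->] ->]]].
move=> [_ /vlineP[z ->] ->].
by exists x, y, z; rewrite /comb [y *: _ + _]addrC.
Qed.

Lemma comb_change u1 u2 u3 a b k x y z :
  comb (u1 + a *: u2) u2 (k *: (u3 + b *: u2)) x y z
  = comb u1 u2 u3 x (y + a * x + k * b * z) (k * z).
Proof. by apply/matrixP => i j; rewrite /comb !mxE; ring. Qed.

Lemma frame_change u1 u2 u3 a b k : k != 0 -> frame u1 u2 u3 ->
  frame (u1 + a *: u2) u2 (k *: (u3 + b *: u2)).
Proof.
move=> k0 [gen ind]; split=> [v|x y z].
  have [x [y [z ->]]] := gen v.
  exists x, (y - a * x - b * z), (k^-1 * z); rewrite comb_change mulVKf //.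
  by congr comb; field.
rewrite comb_change => /ind[-> E /eqP].
rewrite mulf_eq0 (negPf k0) => /eqP z0; move: E; rewrite z0 !mulr0 !addr0.
by [].
Qed.

(** Coordinates in which F is a multiple of the homogeneous Weierstrass
    equation, with o = (0 : 1 : 0) and with z = 0 as tangent line at o. *)
Definition weierstrass_frame (F : ternary_form K 3) (o : point K)
    (u1 u2 u3 : vec) (c al be ga : K) :=
  [/\ c != 0, frame u1 u2 u3, val o = <[u2]>%VS,
   forall x y z, evalv F (comb u1 u2 u3 x y z)
    = c * (x ^+ 3 + al * x ^+ 2 * z + be * x * z ^+ 2 + ga * z ^+ 3
           - y ^+ 2 * z)
 & forall x y z, (comb u1 u2 u3 x y z \in tangent_line F o) = (z == 0)].

(** Take u2 on o, let u1 complete it to a basis of the tangent line and u3 to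
    a basis of the space.  The contact of order three at o removes the monomials
    y^3, x y^2 and x^2 y, and the smoothness at o makes the coefficient of y^2 z
    nonzero.  It remains to complete the square in y and to scale z. *)
Lemma flex_weierstrass (F : ternary_form K 3) (o : point K) : flex F o ->
  exists u1 u2 u3 c al be ga, weierstrass_frame F o u1 u2 u3 c al be ga.
Proof.
move=> [sm flx]; set L := tangent_line F o in flx *.
have dL : \dim L = 2%N := dim_tangent sm.
have oL : (val o <= L)%VS by apply: val_sub_tangent; case: sm.
set u2 := coord_vec o; set u1 := second_vec L o.
have ind := line_independent dL : independent u2 u1.
have EL := line_span dL oL; rewrite -/u1 -/u2 in EL.
have [u3 u3N] : exists u3, u3 \notin L.
  have nfull : ~~ (fullv <= L)%VS.
    by apply/negP => /dimvS; rewrite dL dimvf /dim /= mul1n.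
  by move: nfull => /subvPn[u3 _ u3N]; exists u3.
have fr : frame u1 u2 u3 by apply: frame_of_plane; rewrite -?EL.
have [c Hc] := cubic_coefs F u1 u2 u3.
have [r0 /dvdpP[q Eq]] := line_mult_dvd (isT : (0 < 3)%N) flx.
rewrite -/u1 -/u2 in r0 Eq.
have Er : restr F u2 u1 =
    (c 6%N)%:P + c 3%N *: 'X + c 1%N *: 'X^2 + c 0%N *: 'X^3.
  apply: poly_eval_eq => t; rewrite horner_restr.
  have -> : u2 + t *: u1 = comb u1 u2 u3 t 1 0.
    by rewrite /comb scale1r scale0r addr0 addrC.
  rewrite Hc !(hornerD, hornerZ, hornerXn, hornerX, hornerC).
  by rewrite /cubic_eval; ring.
have coef_r i : (i < 3)%N -> (restr F u2 u1)`_i = 0.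
  by move=> i3; rewrite Eq coefMXn i3.
have c6 : c 6%N = 0.
  by have := coef_r 0%N isT; rewrite Er !coefE /= !mulr0 !addr0.
have c3 : c 3%N = 0.
  by have := coef_r 1%N isT; rewrite Er !coefE /= !mulr0 mulr1 !addr0 add0r.
have c1 : c 1%N = 0.
  by have := coef_r 2%N isT; rewrite Er !coefE /= !mulr0 mulr1 !addr0 !add0r.
have c0 : c 0%N != 0.
  apply: contraNneq r0 => c0.
  by rewrite Er c0 c1 c3 c6 !scale0r !addr0.
have c7 : c 7%N != 0.
  apply: contraNneq u3N => c7; rewrite mem_tangent mul_gradient_eq0.
  have -> : restr F (coord_vec o) u3 = c 9%N *: 'X^3 + c 8%N *: 'X^2.
    apply: poly_eval_eq => t; rewrite horner_restr.
    have -> : coord_vec o + t *: u3 = comb u1 u2 u3 0 1 t.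
      by rewrite /comb scale1r scale0r add0r.
    rewrite Hc !(hornerD, hornerZ, hornerXn, hornerX, hornerC).
    by rewrite /cubic_eval c6 c7; ring.
  rewrite derivD !derivZ !derivXn !(hornerD, hornerZ, hornerMn, hornerXn).
  by rewrite !expr0n /= !(addr0, mulr0).
(* The shifts a and b of y complete the square; k scales z. *)
pose a := - c 4%N / (2%:R * c 7%N); pose b := - c 8%N / (2%:R * c 7%N).
pose k := - (c 0%N / c 7%N).
have k0 : k != 0 by rewrite oppr_eq0 mulf_neq0 ?invr_neq0.
pose D := 4%:R * c 7%N.
pose al := - (c 2%N - c 4%N ^+ 2 / D) / c 7%N.
pose be := (c 5%N - 2%:R * c 4%N * c 8%N / D) * c 0%N / c 7%N ^+ 2.
pose ga := - (c 9%N - c 8%N ^+ 2 / D) * c 0%N ^+ 2 / c 7%N ^+ 3.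
exists (u1 + a *: u2), u2, (k *: (u3 + b *: u2)), (c 0%N), al, be, ga.
split=> //; first exact: frame_change.
- exact: point_vline.
- move=> x y z; rewrite comb_change Hc /cubic_eval c1 c3 c6.
  rewrite /a /b /k /al /be /ga /D; field.
  by rewrite c7.
move=> x y z; rewrite comb_change -/L EL /comb.
have inL x' y' : x' *: u1 + y' *: u2 \in (<[u2]> + <[u1]>)%VS.
  by rewrite addrC memv_add // memvZ // memv_line.
rewrite (rpredDl _ (inL _ _)) rpredZeq -EL (negPf u3N) orbF mulf_eq0 (negPf k0).
by [].
Qed.

End Coordinates.

(** * The chord-tangent law in Weierstrass coordinates *)

Section FrameGeometry.
Variable K : numClosedFieldType.
Variables (F : ternary_form K 3) (o : point K) (u1 u2 u3 : 'rV[K]_3).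
Variables (c al be ga : K).
Hypothesis W : weierstrass_frame F o u1 u2 u3 c al be ga.

Local Notation cmb := (comb u1 u2 u3).
Local Notation h := ('X^3 + al *: 'X^2 + be *: 'X + ga%:P).

Let c0 : c != 0. Proof. by case: W. Qed.
Let evF x y z : evalv F (cmb x y z) = c * (x ^+ 3 + al * x ^+ 2 * z
   + be * x * z ^+ 2 + ga * z ^+ 3 - y ^+ 2 * z).
Proof. by case: W => _ _ _ H _; exact: H. Qed.
Let fr_ind x y z : cmb x y z = 0 -> [/\ x = 0, y = 0 & z = 0].
Proof. by case: W => _ [_ H] _ _ _; exact: H. Qed.
Let fr_gen v : exists x y z, v = cmb x y z.
Proof. by case: W => _ [H _] _ _ _; exact: H. Qed.

Lemma combD k l x y z x' y' z' : k *: cmb x y z + l *: cmb x' y' z' =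
  cmb (k * x + l * x') (k * y + l * y') (k * z + l * z').
Proof. by apply/matrixP => i j; rewrite /comb !mxE; ring. Qed.

Lemma size_h : size h = 4%N.
Proof.
rewrite -!addrA size_polyDl size_polyXn //.
apply: leq_ltn_trans (size_polyD _ _) _; rewrite gtn_max.
rewrite (leq_ltn_trans (size_scale_leq _ _)) ?size_polyXn //=.
exact: leq_ltn_trans (size_mXnC _ _) _.
Qed.

Lemma h_monic : h \is monic.
Proof. by rewrite monicE lead_coefE size_h !coefE /= !mulr0 !addr0. Qed.

Lemma horner_h a : h.[a] = a ^+ 3 + al * a ^+ 2 + be * a + ga.
Proof. by rewrite !(hornerD, hornerZ, hornerXn, hornerX, hornerC). Qed.

Definition coords_vec (T : option (K * K)) :=
  if T is Some q then cmb q.1 q.2 1 else cmb 0 1 0.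

Definition at_coords (x : point K) T := val x = <[coords_vec T]>%VS.

Lemma coords_vec_neq0 T : coords_vec T != 0.
Proof.
case: T => [q|]; apply/eqP => /fr_ind[] _ /eqP; rewrite ?oner_eq0 //.
by move=> _ /eqP; rewrite oner_eq0.
Qed.

Lemma coords_point T : exists x, at_coords x T.
Proof. exact: vline_point (coords_vec_neq0 T). Qed.

Lemma at_origin : at_coords o None.
Proof.
case: W => _ _ E _ _.
by rewrite /at_coords E /= /comb !scale0r add0r addr0 scale1r.
Qed.

Lemma at_coords_point x y T : at_coords x T -> at_coords y T -> x = y.
Proof. by move=> Ex Ey; apply: val_inj; rewrite Ex Ey. Qed.

Lemma at_coords_inj x T T' : at_coords x T -> at_coords x T' -> T = T'.
Proof.
rewrite /at_coords => -> E.
have : coords_vec T \in <[coords_vec T']>%VS by rewrite -E memv_line.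
move=> /vlineP[k Ek].
have : 1 *: coords_vec T + (- k) *: coords_vec T' = 0.
  by rewrite Ek scale1r scaleNr subrr.
case: T {E Ek} => [[a b]|]; case: T' => [[a' b']|];
  rewrite /= combD => /fr_ind[];
  rewrite ?mulr0 ?mulr1 ?mul1r ?addr0 ?add0r //.
- move=> E1 E2 /eqP; rewrite subr_eq0 => /eqP k1.
  by move: E1 E2; rewrite -k1 !mulN1r => /subr0_eq -> /subr0_eq ->.
- by move=> _ _ /eqP; rewrite oner_eq0.
- move=> _ Ey /eqP; rewrite oppr_eq0 => /eqP k0; move/eqP: Ey.
  by rewrite k0 oppr0 mul0r addr0 oner_eq0.
Qed.

Lemma eval_affine a b :
  evalv F (coords_vec (Some (a, b))) = c * (h.[a] - b ^+ 2).
Proof. by rewrite /= evF horner_h; ring. Qed.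

Lemma on_curve_coords x T : at_coords x T -> on_affine h T -> on_curve F x.
Proof.
move=> Ex onT; apply/(on_curveP F Ex); case: T onT {Ex} => [[a b]|].
  by rewrite eval_affine /= => ->; rewrite subrr mulr0.
by rewrite /= evF => _; ring.
Qed.

(** The line at infinity is the tangent at the flex o, so it contains no other
    point of the curve. *)
Lemma curve_coords x : on_curve F x -> exists2 T, at_coords x T & on_affine h T.
Proof.
move=> Fx; have [a [b [d Ev]]] := fr_gen (coord_vec x).
have := Fx _ (memv_pick _); rewrite -/(coord_vec x) Ev => Fv.
have [d0|d0] := eqVneq d 0.
  exists None => //; rewrite /at_coords point_vline Ev d0.
  have a0 : a = 0.
    have /eqP : c * a ^+ 3 = 0 by rewrite -Fv evF d0; ring.
    by rewrite mulf_eq0 (negPf c0) expf_eq0 => /eqP.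
  have b0 : b != 0.
    apply: contraNneq (coord_vec_neq0 x) => b0.
    by rewrite Ev a0 b0 d0 /comb !scale0r !addr0.
  apply/eqP; rewrite eqEdim !dim_vline coords_vec_neq0 -memvE.
  have -> : cmb a b 0 = b *: coords_vec None.
    by apply/matrixP => i j; rewrite /= /comb !mxE a0; ring.
  by rewrite memvZ ?memv_line // scaler_eq0 negb_or b0 coords_vec_neq0.
have E : cmb a b d = d *: coords_vec (Some (a / d, b / d)).
  by apply/matrixP => i j; rewrite /= /comb !mxE; field.
exists (Some (a / d, b / d)).
  rewrite /at_coords point_vline Ev E; apply/eqP.
  rewrite eqEdim !dim_vline coords_vec_neq0 -memvE memvZ ?memv_line //.
  by rewrite scaler_eq0 negb_or d0 coords_vec_neq0.
move: Fv; rewrite E evalv_homog eval_affine => /eqP.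
rewrite mulf_eq0 expf_eq0 mulf_eq0 (negPf d0) (negPf c0) /= subr_eq0.
by move=> /eqP ->.
Qed.

Lemma third_point_of_factorization x1 x2 x3 v w (q1 q2 q3 : K * K) k :
  independent v w -> k != 0 ->
  q1 != (0, 0) -> q2 != (0, 0) -> q3 != (0, 0) ->
  val x1 = <[q1.1 *: v + q1.2 *: w]>%VS ->
  val x2 = <[q2.1 *: v + q2.2 *: w]>%VS ->
  val x3 = <[q3.1 *: v + q3.2 *: w]>%VS ->
  (forall a b, evalv F (a *: v + b *: w) =
    k * ((q1.2 * a - q1.1 * b) * (q2.2 * a - q2.1 * b)
         * (q3.2 * a - q3.1 * b))) ->
  third_point F x1 x2 x3.
Proof.
move=> ind k0 q10 q20 q30 E1 E2 E3 EF; exists (<[v]> + <[w]>)%VS.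
apply: (@line_divisor_of_factorization _ _ F v w
  [:: (x1, q1); (x2, q2); (x3, q3)] k) => //.
  by move=> i; do 3![rewrite in_cons => /orP[/eqP -> //|]].
by move=> a b; rewrite EF !big_cons big_nil /=; ring.
Qed.

Lemma third_point_origin : third_point F o o o.
Proof.
have E : val o = <[1 *: cmb 0 1 0 + 0 *: cmb 1 0 0]>%VS.
  by rewrite at_origin combD /=; congr <[cmb _ _ _]>%VS; ring.
have n0 : ((1 : K), (0 : K)) != (0, 0) by rewrite xpair_eqE oner_eq0.
apply: (third_point_of_factorization (v := cmb 0 1 0) (w := cmb 1 0 0)
   (k := - c) _ _ n0 n0 n0 E E E) => [a b||a b].
- by rewrite combD => /fr_ind[]; rewrite !mulr0 !mulr1 add0r addr0.
- by rewrite oppr_eq0.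
by rewrite combD evF /=; ring.
Qed.

Lemma third_point_vertical x x' a b : b ^+ 2 = h.[a] ->
  at_coords x (Some (a, b)) -> at_coords x' (Some (a, - b)) ->
  third_point F o x x'.
Proof.
move=> onab Ex Ex'.
have n0 : ((1 : K), (0 : K)) != (0, 0) by rewrite xpair_eqE oner_eq0.
have n1 (y : K) : (y, 1 : K) != (0, 0) by rewrite xpair_eqE oner_eq0 andbF.
apply: (third_point_of_factorization (v := cmb 0 1 0) (w := cmb a 0 1) (k := c)
   _ c0 n0 (n1 b) (n1 (- b))) => [s t||||s t].
- rewrite combD => /fr_ind[_]; rewrite !mulr0 !mulr1 add0r addr0.
  by [].
- by rewrite at_origin combD /=; congr <[cmb _ _ _]>%VS; ring.
- by rewrite Ex combD /=; congr <[cmb _ _ _]>%VS; ring.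
- by rewrite Ex' combD /=; congr <[cmb _ _ _]>%VS; ring.
rewrite combD evF /=; rewrite horner_h in onab.
transitivity (c * (t ^+ 3 * (a ^+ 3 + al * a ^+ 2 + be * a + ga) - s ^+ 2 * t)).
  by ring.
by rewrite -onab; ring.
Qed.

Lemma third_point_chord x1 x2 x3 m n a1 a2 a3 :
  h - (m *: 'X + n%:P) ^+ 2
    = ('X - a1%:P) * ('X - a2%:P) * ('X - a3%:P) ->
  at_coords x1 (Some (a1, m * a1 + n)) ->
  at_coords x2 (Some (a2, m * a2 + n)) ->
  at_coords x3 (Some (a3, m * a3 + n)) -> third_point F x1 x2 x3.
Proof.
move=> Eh E1 E2 E3.
have n1 (y : K) : (y, 1 : K) != (0, 0) by rewrite xpair_eqE oner_eq0 andbF.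
apply: (third_point_of_factorization (v := cmb 1 m 0) (w := cmb 0 n 1) (k := c)
   _ c0 (n1 a1) (n1 a2) (n1 a3)) => [s t||||s t].
- by rewrite combD => /fr_ind[]; rewrite !mulr0 !mulr1 add0r addr0.
- by rewrite E1 combD /=; congr <[cmb _ _ _]>%VS; ring.
- by rewrite E2 combD /=; congr <[cmb _ _ _]>%VS; ring.
- by rewrite E3 combD /=; congr <[cmb _ _ _]>%VS; ring.
have El : h - (m *: 'X + n%:P) ^+ 2 = 'X^3 + (al - m ^+ 2) *: 'X^2
   + (be - 2%:R * m * n) *: 'X + (ga - n ^+ 2)%:P.
  by rewrite -!mul_polyC; ring.
have Er : ('X - a1%:P) * ('X - a2%:P) * ('X - a3%:P) =
  'X^3 + (- (a1 + a2 + a3)) *: 'X^2 + (a1 * a2 + a1 * a3 + a2 * a3) *: 'X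
  + (- (a1 * a2 * a3))%:P.
  by rewrite -!mul_polyC; ring.
have Ec i :=
  congr1 (fun p : {poly K} => p`_i) (etrans (esym El) (etrans Eh Er)).
have := Ec 0%N; have := Ec 1%N; have := Ec 2%N.
rewrite !coefE /= !mulr0 !mulr1 !addr0 !add0r => e2 e1 e0.
rewrite combD evF /=.
transitivity (c * (s ^+ 3 + (al - m ^+ 2) * s ^+ 2 * t
  + (be - 2%:R * m * n) * s * t ^+ 2 + (ga - n ^+ 2) * t ^+ 3)); first by ring.
by rewrite e0 e1 e2; ring.
Qed.

Lemma add_point_coords a b p T T' x :
  b ^+ 2 = h.[a] -> at_coords p (Some (a, b)) ->
  affine_add h a b T T' -> at_coords x T -> on_affine h T' ->
  exists2 x', at_coords x' T' & add_point F o x p x'.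
Proof.
move=> onab Ep; case=> [|| m n r s Eb Eh] Ex onT'.
- have [p' Ep'] := coords_point (Some (a, - b)).
  have V := third_point_vertical onab Ep Ep'.
  exists p => //; exists p'.
  rewrite (at_coords_point Ex at_origin).
  by split; [exact: V | exact: (third_point_swap V)].
- exists o; first exact: at_origin.
  exists o; split; last exact: third_point_origin.
  exact: (third_point_rot (third_point_swap (third_point_vertical onab Ep Ex))).
have [y Ey] := coords_point (Some (s, m * s + n)).
have [y' Ey'] := coords_point (Some (s, - (m * s + n))).
exists y' => //; exists y; split.
  by apply: (third_point_chord Eh Ex _ Ey); rewrite -Eb.
by apply: (third_point_vertical _ Ey Ey'); rewrite -sqrrN.
Qed.

End FrameGeometry.

(** * Cubics meeting a given cubic in one point *)

Section CoordinateFunctions.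
Variable K : numClosedFieldType.
Variables (F : ternary_form K 3) (o : point K) (u1 u2 u3 : 'rV[K]_3).
Variables (c al be ga : K).
Hypothesis W : weierstrass_frame F o u1 u2 u3 c al be ga.

Local Notation cmb := (comb u1 u2 u3).
Local Notation h := ('X^3 + al *: 'X^2 + be *: 'X + ga%:P).
Local Notation at_coords := (at_coords u1 u2 u3).
Local Notation coords_vec := (coords_vec u1 u2 u3).

(** If a were a double root of h, then F would vanish to order two in every
    direction at (a, 0). *)
Lemma simple_root_of_smooth x a : smooth_curve F ->
  at_coords x (Some (a, 0)) -> h.[a] = 0 -> h^`().[a] != 0.
Proof.
have [c0 [gen _] _ evF _] := W.
move=> smF Ex ha; apply/eqP => h'a.
have [_] : smooth_at F x.
  by apply/smF/(on_curve_coords W Ex); rewrite /= ha expr0n.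
rewrite -/(coord_vec x) => /negP[].
have : coord_vec x \in <[coords_vec (Some (a, 0%R))]>%VS.
  by rewrite -Ex memv_pick.
move=> /vlineP[k ->].
have Ebe : be = - (3%:R * a ^+ 2 + 2%:R * al * a).
  have : 3%:R * a ^+ 2 + 2%:R * al * a + be = 0.
    rewrite -h'a !derivD derivC !derivZ !derivXn derivX.
    by rewrite !(hornerD, hornerZ, hornerMn, hornerXn, hornerC) /=; ring.
  by move/eqP; rewrite addrC addr_eq0 => /eqP.
have Ega : ga = 2%:R * a ^+ 3 + al * a ^+ 2.
  have : a ^+ 3 + al * a ^+ 2 + be * a + ga = 0 by rewrite -horner_h ha.
  by move/eqP; rewrite addrC addr_eq0 => /eqP ->; rewrite Ebe; ring.
suff H (w : 'rV[K]_3) : w *m gradient F (k *: coords_vec (Some (a, 0))) = 0.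
  apply/eqP/matrixP => i j; have /matrixP/(_ 0 j) := H (delta_mx 0 i).
  by rewrite -rowE mxE => ->; rewrite !mxE.
have [x' [y [z ->]]] := gen w.
apply/eqP; rewrite mul_gradient_eq0.
pose q := c *: ((x' - a * z) ^+ 2 *: ((k * a)%:P + x' *: 'X
  + (2%:R * a + al) *: (k%:P + z *: 'X)) - y ^+ 2 *: (k%:P + z *: 'X)).
have -> : restr F (k *: coords_vec (Some (a, 0))) (cmb x' y z) = q * 'X * 'X.
  apply: poly_eval_eq => t; rewrite horner_restr combD evF.
  rewrite /q !(hornerD, hornerZ, hornerXn, hornerX, hornerC, hornerM, hornerN).
  by rewrite /= Ega Ebe; ring.
rewrite derivM derivX !(hornerD, hornerM, hornerX, hornerC).
by rewrite !mulr0 mul0r addr0.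
Qed.

(** The value at z = 1 of the cubic form with coefficients g, after the
    replacement of y^2 by h and of y^3 by h y. *)
Definition affine_fun (g : nat -> K) : coordring h :=
  (g 3%N *: 'X^4 + (g 0%N + g 7%N + g 3%N * al) *: 'X^3
     + (g 2%N + g 7%N * al + g 3%N * be) *: 'X^2
     + (g 5%N + g 7%N * be + g 3%N * ga) *: 'X + (g 9%N + g 7%N * ga)%:P,
   g 6%N *: 'X^3 + (g 1%N + g 6%N * al) *: 'X^2
     + (g 4%N + g 6%N * be) *: 'X + (g 8%N + g 6%N * ga)%:P).

Lemma eval_affine_fun g s t : t ^+ 2 = h.[s] ->
  cubic_eval g s t 1 = (affine_fun g).1.[s] + (affine_fun g).2.[s] * t.
Proof.
rewrite horner_h /= => Et.
rewrite !(hornerD, hornerZ, hornerXn, hornerX, hornerC) /cubic_eval.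
have -> : t ^+ 3 = t * t ^+ 2 by ring.
by rewrite Et; ring.
Qed.

Lemma norm_root (f : coordring h) s : root (norm f) s ->
  exists2 t, t ^+ 2 = h.[s] & f.1.[s] + f.2.[s] * t = 0.
Proof.
rewrite /root /norm hornerD hornerN horner_exp hornerM horner_exp.
rewrite -[h.[s]]sqrtCK.
rewrite -exprMn subr_sqr mulf_eq0 => /orP[] /eqP E.
  by exists (- sqrtC h.[s]); rewrite ?sqrrN ?sqrtCK // mulrN.
by exists (sqrtC h.[s]); rewrite ?sqrtCK.
Qed.

Section SecondCubic.
Variables (G : ternary_form K 3) (g : nat -> K).
Hypothesis evG : forall x y z, evalv G (cmb x y z) = cubic_eval g x y z.

Lemma common_point_of_root s : root (norm (affine_fun g)) s ->
  exists t x, [/\ at_coords x (Some (s, t)), on_affine h (Some (s, t)),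
    on_curve F x & on_curve G x].
Proof.
move=> /norm_root[t Et E]; have [x Ex] := coords_point W (Some (s, t)).
exists t, x; split=> //; first exact: (on_curve_coords W Ex).
by apply/(on_curveP G Ex); rewrite /= evG eval_affine_fun.
Qed.

(** The function that G defines on the affine part has no zero, so it is a
    constant of the coordinate ring.  This determines all coefficients of G
    except two, that of y^2 z and that of z^3. *)
Lemma cubic_meeting_at_flex :
  (forall x, on_curve F x -> on_curve G x -> x = o) ->
  exists (l : ternary_form K 1) (e1 e2 : K),
    [/\ line_equation l (tangent_line F o), e2 != 0 &
        G = e1 *: F + e2 *: cube l].
Proof.
have [c0 [gen ind] _ evF tgt] := W.
move=> base; set f := affine_fun g.
have sz1 : size (norm f) = 1%N.
  apply/eqP/negPn/negP => /closed_rootP[s /common_point_of_root].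
  move=> [t [x [Ex _ Fx Gx]]].
  have := base x Fx Gx => xo; rewrite xo in Ex.
  by have := at_coords_inj W Ex (at_origin W).
move: sz1; rewrite (size_norm (size_h al be ga)).
have [f20|f20] := eqVneq f.2 0; last first.
  move=> E; have : (4 <= 1)%N; last by [].
  rewrite -{2}E leq_max; apply/orP; right; rewrite !ltnS.
  by move: f20; rewrite -size_poly_gt0; case: (size _).
rewrite maxn0 => szf1; have sz1 : size f.1 = 1%N.
  by move: szf1; case: eqP => //; case: (size f.1) => [|[|[|]]].
have b_coef i : f.2`_i = 0 by rewrite f20 coef0.
have a_coef i : (0 < i)%N -> f.1`_i = 0 by move=> i0; rewrite nth_default ?sz1.
have a0 : f.1`_0 != 0.
  by have := lead_coef_eq0 f.1; rewrite lead_coefE sz1 -size_poly_eq0 sz1 => ->.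
have := b_coef 3; have := b_coef 2; have := b_coef 1%N; have := b_coef 0%N.
rewrite /f !coefE /= !mulr0 !mulr1 !addr0 !add0r => b0 b1 b2 b3.
move: b0 b1 b2; rewrite b3 !mul0r !addr0 => b0 b1 b2.
have := a_coef 4 isT; have := a_coef 3 isT.
have := a_coef 2 isT; have := a_coef 1%N isT.
rewrite /f !coefE /= !mulr0 !mulr1 !addr0 !add0r => a1 a2 a3 a4.
move: a1 a2 a3; rewrite a4 !mul0r !addr0 => a1 a2 a3.
move: a0; rewrite /f !coefE /= !mulr0 !addr0 !add0r => a0.
have [l El] := linear_form (gradient F (coord_vec o)).
have l0 w : (w \in tangent_line F o) = (evalv l w == 0).
  rewrite mem_tangent El; apply/eqP/eqP => [->|E]; first by rewrite mxE.
  by apply/matrixP => i j; rewrite !ord1 E mxE.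
have lD (v w : 'rV[K]_3) t : evalv l (v + t *: w) = evalv l v + t * evalv l w.
  by rewrite !El mulmxDl -scalemxAl mxE [X in _ + X]mxE.
have lz x y z : evalv l (cmb x y z) = z * evalv l (cmb 0 0 1).
  have lxy : evalv l (cmb x y 0) = 0 by apply/eqP; rewrite -l0 tgt.
  have -> : cmb x y z = cmb x y 0 + z *: cmb 0 0 1.
    by apply/matrixP => i j; rewrite /comb !mxE; ring.
  by rewrite lD lxy add0r.
have k0 : evalv l (cmb 0 0 1) != 0 by rewrite -l0 tgt oner_eq0.
set k := evalv l _ in lz k0.
exists l, (- g 7%N / c), ((g 9%N + g 7%N * ga) / k ^+ 3); split.
- split=> //; apply: contraNneq k0 => l00.
  by rewrite /k l00 /evalv meval0.
- by rewrite mulf_neq0 // invr_eq0 expf_neq0.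
apply: form_eval_eq => v; have [x [y [z ->]]] := gen v.
rewrite evalvD !evalvZ evalv_cube lz evF evG /cubic_eval.
have E0 : g 0%N = - g 7%N by apply/eqP; rewrite -addr_eq0 a3.
have E2 : g 2%N = - (g 7%N * al) by apply/eqP; rewrite -addr_eq0 a2.
have E5 : g 5%N = - (g 7%N * be) by apply/eqP; rewrite -addr_eq0 a1.
rewrite E0 E2 E5 a4 b3 b2 b1 b0; field.
by rewrite c0 k0.
Qed.

(** The multiples of p exist and stay in Weierstrass coordinates.  As b is not
    0, the tangent at p is not vertical and can serve as a chord. *)
Lemma multiples_equiv_power a b p k : b != 0 -> b ^+ 2 = h.[a] ->
  at_coords p (Some (a, b)) ->
  exists T x, [/\ at_coords x T, on_affine h T, mul_point F o k p x
     & equiv_power h a b k T].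
Proof.
move=> b0 onab Ep; elim: k => [|k [T [x [Ex onT mulT eqT]]]].
  by exists None, o; split=> //; [exact: at_origin W | exact: equiv_power0].
have two0 : (2%:R : K) != 0 by rewrite pnatr_eq0.
have [T' addT onT'] :=
  affine_add_exists (size_h al be ga) onab (h_monic al be ga) two0 b0 onT.
have [x' Ex' add'] := add_point_coords W onab Ep addT Ex onT'.
exists T', x'; split=> //; first by exists x.
exact: (equiv_power_step (size_h al be ga) onab addT eqT).
Qed.

(** If p is not o, then o is not on G = 0, so G contains the monomial y^3 and
    its norm has degree 9; p being the only common point, this norm is a
    constant times (x - a)^9.  As 9 is odd, p is not a point with y = 0.  Hence
    G does not vanish at the opposite of p, and lies in the ninth power of the
    ideal of p. *)
Lemma nine_torsion p : smooth_curve F -> on_curve F p ->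
  (forall x, on_curve F x -> on_curve G x -> x = p) -> torsion F o 9 p.
Proof.
move=> smF Fp base; have [[[a b]|] Ep onp] := curve_coords W Fp; last first.
  rewrite (at_coords_point Ep (at_origin W)) /torsion.
  elim: 9%N => //= n IH; exists o; split=> //.
  by exists o; split; exact: (third_point_origin W).
have g6 : g 6%N != 0.
  apply/eqP => g6; have Eo := at_origin W.
  have op : o = p.
    apply: base; first exact: (on_curve_coords W Eo).
    by apply/(on_curveP G Eo); rewrite /= evG /cubic_eval g6; ring.
  by rewrite op in Eo; have := at_coords_inj W Eo Ep.
set f := affine_fun g.
have f2 : size f.2 = 4%N.
  rewrite /f /= -!addrA size_polyDl size_scale ?size_polyXn //.
  apply: leq_ltn_trans (size_polyD _ _) _; rewrite gtn_max.
  rewrite (leq_ltn_trans (size_scale_leq _ _)) ?size_polyXn //=.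
  exact: leq_ltn_trans (size_mXnC _ _) _.
have f1 : (size f.1 <= 5)%N.
  by apply/leq_sizeP => i; rewrite /f !coefE; case: i => [|[|[|[|[|i]]]]] //= _;
    rewrite !mulr0 !addr0.
have szN : size (norm f) = 10%N.
  rewrite (size_norm (size_h al be ga)) f2.
  have -> : (f.2 == 0) = false by rewrite -size_poly_eq0 f2.
  apply/maxn_idPr; case: ifP => // _; apply: leq_trans (leq_pred _) _.
  by rewrite -[4.*2.+2]/5.*2 leq_double.
have N0 : norm f != 0 by rewrite -size_poly_gt0 szN.
have [|k k0] := @poly_one_root _ (norm f) a N0.
  move=> s /common_point_of_root[t [x [Ex onx Fx Gx]]].
  move: Ex; rewrite (base x Fx Gx) => /(at_coords_inj W Ep).
  by case.
rewrite szN /= => EN.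
have b0 : b != 0.
  apply/eqP => b0; rewrite b0 in Ep onp.
  have ha : h.[a] = 0 by rewrite -onp expr0n.
  have h'a := simple_root_of_smooth smF Ep ha.
  exact: (@ramified_norm_odd _ _ (size_h al be ga) _ _ 4 f ha h'a k0 EN).
have fa : f.1.[a] - f.2.[a] * b != 0.
  apply: contra_neq b0 => fab; have [y Ey] := coords_point W (Some (a, - b)).
  have ony : on_affine h (Some (a, - b)) by rewrite /= sqrrN.
  have yp : y = p.
    apply: base; first exact: (on_curve_coords W Ey ony).
    apply/(on_curveP G Ey); rewrite /= evG eval_affine_fun //.
    by rewrite mulrN.
  rewrite yp in Ey; have [/eqP] := at_coords_inj W Ep Ey.
  by rewrite -addr_eq0 -mulr2n mulrn_eq0 => /eqP.
have If := power_of_ideal EN fa.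
have [[q|] [x [Ex onx mulx eqx]]] := multiples_equiv_power 9 b0 onp Ep.
  have f0 : f != 0 by rewrite -(norm_eq0 (size_h al be ga)).
  case: (not_principal (size_h al be ga) If _ f0 eqx).
  by rewrite /deg_norm szN.
by rewrite /torsion -{2}(at_coords_point Ex (at_origin W)).
Qed.

End SecondCubic.
End CoordinateFunctions.

(** * Reducible cubics *)

Section Factor.
Variable K : numFieldType.

Lemma mpoly_affine n (b : {mpoly K[n]}) : (msize b <= 2)%N ->
  b = (b@_0)%:MP + \sum_i b@_U_(i) *: 'X_i.
Proof.
move=> szb; apply/mpolyP => m; rewrite mcoeffD mcoeffC raddf_sum /=.
have [m0|m0] := eqVneq 0%MM m.
  rewrite -m0 mulr1 big1 ?addr0 // => i _.
  by rewrite mcoeffZ mcoeffX mnm1_eq0 mulr0.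
rewrite mulr0 add0r; have [/mdeg1P[i /eqP ->]|m1] := boolP (mdeg m == 1%N).
  rewrite (bigD1 i) //= mcoeffZ mcoeffX eqxx mulr1 big1 ?addr0 // => j ji.
  by rewrite mcoeffZ mcoeffX eq_mnm1 (negPf ji) mulr0.
rewrite big1 => [|i _].
  apply: memN_msupp_eq0; apply: msize_mdeg_ge; apply: leq_trans szb _.
  by move: m0 m1; rewrite eq_sym -mdeg_eq0; case: (mdeg m) => [|[|]].
rewrite mcoeffZ mcoeffX; case: (U_(i)%MM =P m) m1 => [<-|_ _].
  by rewrite mdeg1.
by rewrite mulr0.
Qed.

Lemma eval_ray n (p : {mpoly K[n]}) (w : 'I_n -> K) k : (msize p <= k)%N ->
  exists2 q : {poly K},
    (size q <= k)%N & forall t, q.[t] = p.@[fun i => t * w i].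
Proof.
move=> szp.
exists (\sum_(m <- msupp p) (p@_m * \prod_i w i ^+ m i) *: 'X^(mdeg m)).
  apply: leq_trans (size_sum _ _ _) _; apply/bigmax_leqP_seq => m mp _.
  apply: leq_trans (size_scale_leq _ _) _; rewrite size_polyXn.
  exact: leq_trans (msize_mdeg_lt mp) szp.
move=> t; rewrite horner_sum mevalE; apply: eq_bigr => m _.
rewrite hornerZ hornerXn -mulrA; congr (_ * _).
rewrite mdegE -prodrXr -big_split /=; apply: eq_bigr => i _.
by rewrite exprMn mulrC.
Qed.

Lemma nonunit_msize n (b : {mpoly K[n]}) : b != 0 -> b \isn't a GRing.unit ->
  (2 <= msize b)%N.
Proof.
move=> b0; apply: contraR; rewrite -leqNgt => sz.
have /msize_poly1P[c c0 ->] : msize b == 1%N.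
  by move: sz b0; rewrite -msize_poly_eq0; case: (msize b) => [|[|]].
by rewrite rmorph_unit // unitfE.
Qed.

(** Let F = b c with b of degree 1 and linear part g.  If g vanishes at w, then
    b is constant on the ray through w.  On this ray F is t^d F(w), while c has
    degree less than d, so that F(w) = 0.  The argument does not require b and c
    to be homogeneous. *)
Lemma line_of_linear_factor d (F : ternary_form K d) (b c : {mpoly K[3]}) :
  (F : {mpoly K[3]}) = b * c -> msize b = 2%N -> (msize c <= d)%N ->
  exists2 g : 'cV[K]_3, g != 0 &
    forall w : 'rV[K]_3, w *m g = 0 -> evalv F w = 0.
Proof.
move=> EF szb szc; pose g : 'cV[K]_3 := \col_i b@_U_(i).
have Eb : b = (b@_0)%:MP + \sum_i b@_U_(i) *: 'X_i.
  by apply: mpoly_affine; rewrite szb.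
exists g => [|w gw].
  apply/eqP => g0; have : (msize b <= 1)%N; last by rewrite szb.
  rewrite Eb big1 ?addr0 ?msizeC; first by case: eqP.
  move=> i _; have := congr1 (fun A : 'cV[K]_3 => A i 0) g0.
  by rewrite !mxE => ->; rewrite scale0r.
have [q szq Eq] := eval_ray (w 0) szc.
have Ebw t : b.@[fun i => t * w 0 i] = b@_0.
  rewrite Eb mevalD mevalC raddf_sum /= -[in RHS]Eb.
  rewrite (eq_bigr (fun i => t * (w 0 i * g i 0))).
    have := congr1 (fun A : 'M[K]_1 => A 0 0) gw; rewrite !mxE -mulr_sumr => ->.
    by rewrite mulr0 addr0.
  by move=> i _; rewrite mevalZ mevalXU mxE; ring.
have E : evalv F w *: 'X^d = b@_0 *: q.
  apply: poly_eval_eq => t.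
  rewrite !hornerZ hornerXn Eq -{1}(Ebw t) -mevalM -EF.
  rewrite mulrC -evalv_homog /evalv; apply: meval_eq => i.
  by rewrite mxE.
have := congr1 (fun r : {poly K} => r`_d) E.
by rewrite !coefZ coefXn eqxx mulr1 (nth_default _ szq) mulr0.
Qed.

Lemma line_of_reducible (F : ternary_form K 3) (b c : {mpoly K[3]}) :
  F != 0 -> (F : {mpoly K[3]}) = b * c ->
  b \isn't a GRing.unit -> c \isn't a GRing.unit ->
  exists2 g : 'cV[K]_3, g != 0 &
    forall w : 'rV[K]_3, w *m g = 0 -> evalv F w = 0.
Proof.
move=> F0 EF Nb Nc.
have bc0 : b * c != 0 by rewrite -EF; apply: contra_neq F0 => E; exact: val_inj.
have [b0 c0] : b != 0 /\ c != 0 by apply/andP; rewrite -negb_or -mulf_eq0.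
have szF : (msize (b * c) <= 4)%N.
  rewrite -EF mmeasureE; apply/bigmax_leqP_seq => m mF _.
  by have /= -> := dhomog_mf (dhomog_is_dhomog F) mF.
have szb := nonunit_msize b0 Nb; have szc := nonunit_msize c0 Nc.
rewrite msizeM // in szF.
have [szb2|szb2] := eqVneq (msize b) 2%N.
  by apply: (line_of_linear_factor EF szb2); move: szF; rewrite szb2.
apply: (line_of_linear_factor (b := c) (c := b)); first by rewrite EF mulrC.
  by move: szF szb szc szb2; move: (msize b) (msize c) => m n; lia.
by move: szF szb szc szb2; move: (msize b) (msize c) => m n; lia.
Qed.

Lemma form_not_unit (F : ternary_form K 3) :
  (F : {mpoly K[3]}) \isn't a GRing.unit.
Proof.
have F0 : (F : {mpoly K[3]}).@[fun=> 0] = 0.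
  have := evalv_homog F 0 0; rewrite expr0n mul0r /evalv => E; rewrite -[RHS]E.
  by apply: meval_eq => i; rewrite scale0r mxE.
apply/negP => /(rmorph_unit (meval (fun _ : 'I_3 => (0 : K)))).
by rewrite /= F0 unitr0.
Qed.
End Factor.

(** * Pencils with one base point *)

Section Pencil.
Variable K : numClosedFieldType.
Local Notation form := (ternary_form K 3).

Lemma restr_cubic (F : form) v w : exists c : nat -> K,
  [/\ forall x y, evalv F (x *: v + y *: w)
        = c 0%N * x ^+ 3 + c 1%N * x ^+ 2 * y + c 3%N * x * y ^+ 2
          + c 6%N * y ^+ 3
    & restr F v w
        = (c 0%N)%:P + c 1%N *: 'X + c 3%N *: 'X^2 + c 6%N *: 'X^3].
Proof.
have [c Hc] := cubic_coefs F v w 0.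
have E x y : evalv F (x *: v + y *: w)
    = c 0%N * x ^+ 3 + c 1%N * x ^+ 2 * y + c 3%N * x * y ^+ 2 + c 6%N * y ^+ 3.
  have -> : x *: v + y *: w = comb v w 0 x y 0 by rewrite /comb scaler0 addr0.
  by rewrite Hc /cubic_eval; ring.
exists c; split=> //; apply: poly_eval_eq => t.
rewrite horner_restr -[v]scale1r E.
by rewrite !(hornerD, hornerZ, hornerXn, hornerX, hornerC); ring.
Qed.

(** A binary cubic form that has at most one zero has exactly one, of
    multiplicity three.  The line L is then the tangent at this zero. *)
Lemma flex_of_line (F : form) (L : {vspace 'rV[K]_3}) (p : point K) :
  smooth_curve F -> \dim L = 2%N ->
  (forall x, (val x <= L)%VS -> on_curve F x -> x = p) -> flex F p.
Proof.
move=> smF dL base.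
have zero_vec v : v != 0 -> v \in L -> evalv F v = 0 -> val p = <[v]>%VS.
  move=> v0 vL Fv; have [x Ex] := vline_point v0.
  rewrite -(base x) //; first by rewrite Ex -memvE.
  by apply/(on_curveP F Ex).
(* The form has a zero on L: either a root of its dehomogenization, or the
   point at infinity if the leading coefficient vanishes. *)
have pL : (val p <= L)%VS.
  have v0 : vpick L != 0 by rewrite vpick0 -dimv_eq0 dL.
  have [x Ex] := vline_point v0.
  have xL : (val x <= L)%VS by rewrite Ex -memvE memv_pick.
  set v := coord_vec x; set w := second_vec L x.
  have ind : independent v w := line_independent dL.
  have vL : v \in L by apply: subvP xL _ _; exact: memv_pick.
  have wL : w \in L by exact: subvP (diffvSl _ _) _ (memv_pick _).
  have [c [EF Er]] := restr_cubic F v w.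
  have [c6|c6] := eqVneq (c 6%N) 0.
    rewrite (@zero_vec w) -?memvE //; first exact: (second_vec_neq0 x dL).
    by have := EF 0 1; rewrite scale0r scale1r add0r c6 => ->; ring.
  have : size (restr F v w) != 1%N.
    have : (restr F v w)`_3 != 0.
      by rewrite Er !coefE /= !mulr0 mulr1 !add0r.
    by apply: contra_neq => sz; rewrite nth_default // sz.
  move=> /closed_rootP[t /rootP]; rewrite horner_restr => Ft.
  rewrite (@zero_vec (v + t *: w)) -?memvE ?memvD ?memvZ //.
  apply/eqP => /eqP; rewrite -[v]scale1r => /eqP /ind[/eqP].
  by rewrite oner_eq0.
set v := coord_vec p; set w := second_vec L p.
have ind : independent v w := line_independent dL.
have vL : v \in L by apply: subvP pL _ _; exact: memv_pick.
have wL : w \in L by exact: subvP (diffvSl _ _) _ (memv_pick _).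
have [c [EF Er]] := restr_cubic F v w.
have pE : val p = <[1 *: v + 0 *: w]>%VS.
  by rewrite scale1r scale0r addr0; exact: point_vline.
have nz (a b : K) : a != 0 \/ b != 0 -> (a, b) != (0, 0).
  by rewrite xpair_eqE negb_and => -[->|->]; rewrite ?orbT.
(* Every zero of the form on L is p, so it has b = 0 as p has the coordinates
   (1, 0). *)
have only a b : (a, b) != (0, 0) -> evalv F (a *: v + b *: w) = 0 -> b = 0.
  move=> ab Fab; have : val p = <[a *: v + b *: w]>%VS.
    apply: zero_vec => //; last by rewrite memvD ?memvZ.
    by apply: contra_neq ab => /ind[-> ->].
  rewrite pE => /eqP; rewrite vline_eqE //; last first.
    by apply: nz; left; exact: oner_neq0.
  by rewrite mul1r mul0r => /eqP.
have c6 : c 6%N != 0.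
  apply/eqP => c6; have F01 : evalv F (0 *: v + 1 *: w) = 0.
    by rewrite EF c6; ring.
  have := only 0 1 (nz _ _ (or_intror (oner_neq0 K))) F01.
  by move/eqP; rewrite oner_eq0.
have c63 : (restr F v w)`_3 = c 6%N.
  by rewrite Er !coefE /= !mulr0 mulr1 !add0r.
have szr : size (restr F v w) = 4%N.
  apply/eqP; rewrite eqn_leq; apply/andP; split; last first.
    by rewrite ltnNge; apply: contraNN c6 => sz; rewrite -c63 nth_default.
  by apply/leq_sizeP => i; rewrite Er !coefE; case: i => [|[|[|[|i]]]] //= _;
    rewrite !mulr0 !addr0.
have r0 : restr F v w != 0 by rewrite -size_poly_gt0 szr.
have [|k k0] := @poly_one_root _ (restr F v w) 0 r0.
  move=> t /rootP; rewrite horner_restr -[v]scale1r.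
  by apply: only; apply: nz; left; exact: oner_neq0.
rewrite szr /= => Ek.
have m3 : line_mult F L p = 3%N.
  rewrite /line_mult -/(coord_vec p) -/(second_vec L p) -/v -/w Ek -mul_polyC.
  by rewrite mupMr ?rootC // mup_XsubCX eqxx.
have Fp : on_curve F p by apply: (@line_mult_on_curve _ _ F L); rewrite m3.
have sp := smF p Fp; split=> //.
by rewrite -(line_mult_tangent sp dL pL) m3.
Qed.

(** As o is a flex, the third point on the line through o and o is o itself.
    Unfolding 3 p = o with the uniqueness of third points, one finds that 2 p, p
    and o are collinear; so are o, 2 p and the third point of the tangent at p,
    which must therefore be p. *)
Lemma three_torsion_flex (F : form) (o p : point K) :
  smooth_curve F -> flex F o -> torsion F o 3 p -> flex F p.
Proof.
move=> smF flo.
have [u1 [u2 [u3 [c [al [be [ga W]]]]]]] := flex_weierstrass flo.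
have ooo := third_point_origin W.
have uniq3 := third_point_unique smF.
move=> [T2 [[T1 [[T0 [-> [R0 [o1 o2]]]] [R1 [p1 p2]]]] [R2 [q1 q2]]]].
have ET1 : T1 = p by exact: uniq3 o2 (third_point_swap o1).
rewrite ET1 in p1.
have ER2 : R2 = o by exact: uniq3 (third_point_swap q2) ooo.
rewrite ER2 in q1.
have ER1 : R1 = p.
  exact: uniq3 (third_point_rot (third_point_rot p2)) (third_point_swap q1).
rewrite ER1 in p1; case: p1 => L D.
have [Fp _ _] := line_divisor_line smF D; rewrite eqxx => EL.
split; first exact: smF.
have [_ inL mL] := D.
have pL := inL _ (mem_head _ _).
by rewrite -EL (mL _ pL) /= eqxx.
Qed.

Variables (V : {vspace form}) (p : point K).
Hypothesis dimV : \dim V = 2%N.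
Hypothesis baseV : forall x, base_point V x <-> x = p.

Lemma pencil_span F G : F != 0 -> F \in V -> G \in V -> G \notin <[F]>%VS ->
  V = (<[F]> + <[G]>)%VS.
Proof.
move=> F0 FV GV GF; apply/esym/eqP.
rewrite eqEdim subv_add -!memvE FV GV /= dimV.
have G0 : G != 0 by apply: contraNneq GF => ->; rewrite mem0v.
rewrite dimv_disjoint_sum ?dim_vline ?F0 ?G0 //.
apply/eqP; rewrite -subv0; apply/subvP => u /memv_capP[uF /vlineP[k E]].
have [k0|k0] := eqVneq k 0; first by rewrite E k0 scale0r mem0v.
case/negP: GF; rewrite -[G]scale1r -(mulVf k0) -scalerA -E.
exact: memvZ.
Qed.

Lemma base_common F G x : F != 0 -> F \in V -> G \in V -> G \notin <[F]>%VS ->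
  on_curve F x -> on_curve G x -> x = p.
Proof.
move=> F0 FV GV GF Fx Gx; apply/baseV => H [].
rewrite (pencil_span F0 FV GV GF).
move=> /memv_addP[_ /vlineP[k ->] [_ /vlineP[l ->] ->]] _ v vx.
by rewrite evalvD !evalvZ Fx // Gx // !mulr0 addr0.
Qed.

Lemma member_on F : F \in V -> F != 0 -> on_curve F p.
Proof. by move=> FV F0; apply: (proj2 (baseV p) erefl). Qed.

Lemma other_member F : exists2 G, G \in V & G \notin <[F]>%VS.
Proof.
apply/subvPn; apply/negP => /dimvS; rewrite dimV dim_vline.
by case: (_ != 0).
Qed.

Lemma flex_pencil F : F != 0 -> F \in V -> flex F p ->
  exists2 l : ternary_form K 1, line_equation l (tangent_line F p) &
    V = (<[F]> + <[cube l]>)%VS.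
Proof.
move=> F0 FV flF.
have [u1 [u2 [u3 [c [al [be [ga W]]]]]]] := flex_weierstrass flF.
have [G GV GF] := other_member F.
have [g Hg] := cubic_coefs G u1 u2 u3.
have base x := @base_common F G x F0 FV GV GF.
have [l [e1 [e2 [Hl e20 EG]]]] := cubic_meeting_at_flex W Hg base.
exists l => //; apply: pencil_span => //.
  have -> : cube l = e2^-1 *: (G - e1 *: F).
    by rewrite EG addrAC subrr add0r scalerA mulVf // scale1r.
  by rewrite memvZ // memvB // memvZ.
apply: contra GF => /vlineP[k El].
by rewrite EG El scalerA -scalerDl memvZ // memv_line.
Qed.

(** The cube of l has a triple zero on the line l = 0. *)
Lemma gradient_add_cube (F : form) (l : ternary_form K 1) a b v
    (w : 'rV[K]_3) :
  evalv l v = 0 ->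
  (w *m gradient (a *: F + b *: cube l) v) 0 0 = a * (w *m gradient F v) 0 0.
Proof.
move=> lv; rewrite -!deriv_restr.
have -> : restr (a *: F + b *: cube l) v w
    = a *: restr F v w + b *: (restr l v w) ^+ 3.
  apply: poly_eval_eq => t.
  rewrite horner_restr evalvD !evalvZ evalv_cube hornerD !hornerZ horner_exp.
  by rewrite !horner_restr.
rewrite derivD !derivZ deriv_exp hornerD !hornerZ !hornerMn !hornerM.
rewrite horner_restr scale0r addr0 lv.
by rewrite ?(mulr0, mul0r, mul0rn, addr0).
Qed.

(** Write H = a F + b l^3, where l = 0 is the tangent to F at p.  On this line H
    and a F coincide, and so do their gradients at p. *)
Lemma flex_of_flex_member F H :
  F != 0 -> F \in V -> flex F p -> H \in V -> smooth_curve H -> flex H p.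
Proof.
move=> F0 FV flF HV smH.
have [l [l0 Hl] EV] := flex_pencil F0 FV flF.
move: HV (HV); rewrite {1}EV.
move=> /memv_addP[_ /vlineP[a ->] [_ /vlineP[b ->] EH]] HV.
have H0 : H != 0.
  apply/eqP => H0; have [x _] := vline_point (coord_vec_neq0 p).
  have [] := smH x; first by move=> v _; rewrite H0; exact: meval0.
  move=> _ /eqP[]; apply/matrixP => i j; rewrite !mxE H0 /=.
  by rewrite /evalv mderiv0 meval0.
have Hp := member_on HV H0; have Fp := member_on FV F0.
have pT : coord_vec p \in tangent_line F p.
  by apply: subvP (val_sub_tangent Fp) _ _; exact: memv_pick.
have lp : evalv l (coord_vec p) = 0 by apply/eqP; rewrite -Hl.
have sp := smH p Hp.
have grad (w : 'rV[K]_3) : (w *m gradient H (coord_vec p)) 0 0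
    = a * (w *m gradient F (coord_vec p)) 0 0.
  by rewrite EH gradient_add_cube.
have a0 : a != 0.
  apply: contraNneq sp.2 => a0; apply/eqP/matrixP => i j.
  have := grad (delta_mx 0 i); rewrite a0 mul0r -rowE mxE (ord1 j) => ->.
  by rewrite mxE.
have ET : tangent_line H p = tangent_line F p.
  apply/vspaceP => w; rewrite !mem_tangent !mul_gradient_eq0 !deriv_restr grad.
  by rewrite mulf_eq0 (negPf a0).
split=> //; rewrite ET; case: flF => sF.
have dL := dim_tangent sF.
rewrite /line_mult -!/(coord_vec p) -!/(second_vec _ p).
set w := second_vec _ p.
have wT : w \in tangent_line F p by exact: subvP (diffvSl _ _) _ (memv_pick _).
have -> : restr H (coord_vec p) w = a%:P * restr F (coord_vec p) w.
  apply: poly_eval_eq => t; rewrite hornerM hornerC !horner_restr EH.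
  rewrite evalvD !evalvZ evalv_cube.
  have -> : evalv l (coord_vec p + t *: w) = 0.
    by apply/eqP; rewrite -Hl memvD ?memvZ.
  by rewrite expr0n mulr0 addr0.
by rewrite mupMr ?rootC.
Qed.

(** Multiply the form h by a linear form that vanishes at the coordinates of G:
    the product is not zero, so it takes a nonzero value at some member. *)
Lemma smooth_member_not_multiple G :
  general_member V (fun F => smooth_curve F) ->
  G != 0 -> G \in V ->
  exists F, [/\ F \in V, F != 0, smooth_curve F & F \notin <[G]>%VS].
Proof.
move=> [e [h [_ h0 Hh]]] G0 GV.
have fX : free (vbasis V) := basis_free (vbasisP V).
have [i0 gi0] : exists i, coord (vbasis V) i G != 0.
  apply/existsP; apply: contraNT G0; rewrite negb_exists => /forallP g0.
  rewrite (coord_vbasis GV) big1 // => i _.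
  by have := g0 i; rewrite negbK => /eqP ->; rewrite scale0r.
have [i1 i10] : exists i1 : 'I_(\dim V), i1 != i0.
  apply/existsP; rewrite -[[exists _, _]]negbK negb_exists.
  apply/negP => /forallP all0.
  have : (#|'I_(\dim V)| <= 1)%N.
    have eq0 i : i = i0 by apply/eqP/negPn/all0.
    by apply/fintype_le1P => i j; rewrite (eq0 i) (eq0 j).
  by rewrite card_ord dimV.
pose g i := coord (vbasis V) i G.
pose psi : {mpoly K[\dim V]} := g i0 *: 'X_i1 - g i1 *: 'X_i0.
have ev v : psi.@[v] = g i0 * v i1 - g i1 * v i0.
  by rewrite mevalB !mevalZ !mevalXU.
have psi0 : psi != 0.
  apply: contraNneq gi0 => psi0.
  have := ev (fun i => (i == i1)%:R); rewrite psi0 meval0 eqxx.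
  rewrite eq_sym (negPf i10) mulr1 mulr0 subr0 => E.
  exact/eqP/esym/E.
have [v hv] : exists v, (h * psi).@[v] != 0.
  apply: boolp.contrapT => nv; have /eqP[] : h * psi != 0 by rewrite mulf_neq0.
  apply: mpoly_eval0 => v; apply/eqP/negPn/negP => hv; apply: nv; by exists v.
move: hv; rewrite mevalM mulf_eq0 negb_or => /andP[hv psiv].
pose F := \sum_(i < \dim V) v i *: (vbasis V)`_i.
have cF i : coord (vbasis V) i F = v i by rewrite coord_sum_free.
have FG : F \notin <[G]>%VS.
  apply: contra psiv => /vlineP[k EF]; apply/eqP; rewrite ev.
  have vE i : v i = k * g i by rewrite -cF EF linearZ.
  by rewrite !vE; ring.
have FV : F \in V.
  apply: memv_suml => i _.
  by rewrite memvZ // vbasis_mem // mem_nth ?size_tuple.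
have F0 : F != 0 by apply: contraNneq FG => ->; rewrite mem0v.
exists F; split=> //; apply: Hh => //.
by rewrite (meval_eq _ cF).
Qed.

Lemma pencil_dichotomy : general_member V (fun F => smooth_curve F) ->
  ((forall F : form, member V F -> irreducible_elt (F : {mpoly K[3]})) /\
   (forall F : form, member V F -> smooth_curve F ->
      forall o : point K, flex F o -> torsion F o 9 p /\ ~ torsion F o 3 p))
  \/
  (forall F : form, member V F -> smooth_curve F ->
     flex F p /\
     exists l : ternary_form K 1,
       line_equation l (tangent_line F p) /\ V = (<[F]> + <[cube l]>)%VS).
Proof.
move=> gen.
have [[F [FV F0] flF]|noflex] :=
    boolp.EM (exists2 F, member V F & flex F p).
  right=> H [HV H0] smH.
  have flH := flex_of_flex_member F0 FV flF HV smH.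
  by split=> //; have [l Hl EV] := flex_pencil H0 HV flH; exists l.
left; split=> [F [FV F0]|F [FV F0] smF o flo].
  split; first by apply: contra_neq F0 => E; exact: val_inj.
    exact: form_not_unit.
  move=> b c EF; have [|Nb] := boolP (b \is a GRing.unit); first by left.
  have [|Nc] := boolP (c \is a GRing.unit); first by right.
  have [g g0 Hg] := line_of_reducible F0 EF Nb Nc.
  have [H [HV H0 smH HF]] := smooth_member_not_multiple gen F0 FV.
  case: noflex; exists H => //; apply: (flex_of_line smH (dim_kernel g0)).
  move=> x xL Hx; apply: (base_common F0 FV HV HF _ Hx) => v vx.
  apply: Hg; have := subvP xL v vx; rewrite memv_ker lfunE => /eqP.
  by [].
split; last first.
  by move=> /(three_torsion_flex smF flo) flp; apply: noflex; exists F.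
have [u1 [u2 [u3 [c [al [be [ga W]]]]]]] := flex_weierstrass flo.
have [G GV GF] := other_member F.
have [g Hg] := cubic_coefs G u1 u2 u3.
apply: (nine_torsion W Hg smF (member_on FV F0)) => x.
exact: base_common.
Qed.

End Pencil.

Theorem proposition3p3 (R : realType) (V : {vspace ternary_form (complex R) 3})
    (p : point (complex R)) :
  \dim V = 2%N ->
  (forall x : point (complex R), base_point V x <-> x = p) ->
  general_member V (fun F => smooth_curve F) ->
  ((forall F : ternary_form (complex R) 3, member V F ->
      irreducible_elt (F : {mpoly (complex R)[3]})) /\
   (forall F : ternary_form (complex R) 3, member V F -> smooth_curve F ->
      forall o : point (complex R), flex F o ->
        torsion F o 9 p /\ ~ torsion F o 3 p))
  \/
  (forall F : ternary_form (complex R) 3, member V F -> smooth_curve F ->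
     flex F p /\
     exists l : ternary_form (complex R) 1,
       line_equation l (tangent_line F p) /\
       V = (<[F]> + <[cube l]>)%VS).
Proof. exact: pencil_dichotomy. Qed.
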